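(* Let $p>2$, let $\Omega\subset\mathbb{R}^n$ be a smooth bounded domain, let $\phi\in X$ and assume $T^*=T^*(\phi)<\infty$. Let $u$ be the corresponding solution. Then there exists a constant $C_1>0$ such that $$\|\nabla u(t)\|_\infty\ge C_1(T^*-t)^{-1/(p-2)},\quad t\to T^*_-,$$ i.e. the inequality holds for all $t<T^*$ sufficiently close to $T^*$.
   Context: $X=\{\phi\in C^1(\overline\Omega):\ \phi=0 \text{ on }\partial\Omega\}$. For $\phi\in X$, consider the problem $u_t-\Delta u=|\nabla u|^p$ for $t>0$, $x\in\Omega$; $u=0$ for $t>0$, $x\in\partial\Omega$; $u(0,x)=\phi(x)$ for $x\in\Omega$. It admits a unique maximal classical solution $u$, with existence time $T^*(\phi)\in(0,\infty]$: $u\in C^{1,2}((0,T^* )\times\overline\Omega)$, $\nabla u\in C([0,T^* )\times\overline\Omega)$, and if $T^*<\infty$ then $\|\nabla u(t)\|_\infty\to\infty$ as $t\to T^*_-$ (gradient blow-up). $\|\cdot\|_\infty$ denotes the sup norm over $\Omega$. *)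

(* Defs.v *)
From HB Require Import structures.
From mathcomp Require Import all_boot all_order all_algebra.
From mathcomp Require Import all_classical all_reals all_analysis.

Set Implicit Arguments.
Unset Strict Implicit.
Unset Printing Implicit Defensive.

Import Order.TTheory GRing.Theory Num.Theory.
Import numFieldNormedType.Exports.

Local Open Scope classical_set_scope.
Local Open Scope ring_scope.

Section calculus.
Context {R : realType} {n : nat}.
Implicit Types (f : 'rV[R]_n -> R) (x : 'rV[R]_n).

(* The library norm `|v| on 'rV[R]_n is the max norm. *)
Definition enorm (v : 'rV[R]_n) : R := Num.sqrt (\sum_i v ord0 i ^+ 2).

Definition basis_vec (i : 'I_n) : 'rV[R]_n := delta_mx ord0 i.

Definition partial (i : 'I_n) f x : R := 'D_(basis_vec i) f x.

Definition grad f x : 'rV[R]_n := \row_i partial i f x.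

Definition laplacian f x : R := \sum_i partial i (partial i f) x.

Definition iter_partial (s : seq 'I_n) f : 'rV[R]_n -> R := foldr partial f s.

(* On an open set U this is the usual C^oo: iterated partial derivatives of
   every order exist and, being differentiable, are continuous. *)
Definition smooth_on (U : set 'rV[R]_n) f : Prop :=
  forall (s : seq 'I_n) x, U x -> differentiable (iter_partial s f) x.

End calculus.

Definition frontier {T : topologicalType} (A : set T) : set T :=
  closure A `\` interior A.

Definition extends_continuously {T V : topologicalType} (A B : set T)
    (f : T -> V) : Prop :=
  exists g : T -> V,
    {within B, continuous g} /\ (forall x, A x -> f x = g x).

(* Smoothness of the boundary is expressed by local C^oo defining functions
   with nonvanishing gradient. *)
Record smooth_bounded_domain {R : realType} {n : nat}
    (Omega : set 'rV[R]_n) : Prop := {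
  sbd_nonempty : Omega !=set0;
  sbd_open : open Omega;
  sbd_connected : connected Omega;
  sbd_bounded : bounded_set Omega;
  sbd_smooth : forall x0, frontier Omega x0 ->
    exists (U : set 'rV[R]_n) (rho : 'rV[R]_n -> R),
      [/\ open U, U x0, smooth_on U rho, grad rho x0 != 0
        & Omega `&` U = [set x | U x /\ rho x < 0]] }.

Section viscous_hamilton_jacobi.
Context {R : realType} {n : nat}.
Variables (p : R) (Omega : set 'rV[R]_n).

(* Functions on the closure of Omega are represented by total functions, of
   which only the values on that closure matter.  Derivatives are taken at
   interior points and required to extend continuously up to the boundary. *)

Record initial_space (phi : 'rV[R]_n -> R) : Prop := {
  X_continuous : {within closure Omega, continuous phi};
  X_derivable : forall i x, Omega x -> derivable phi x (basis_vec i);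
  X_grad_continuous :
    extends_continuously Omega (closure Omega) (grad phi);
  X_zero_boundary : forall x, frontier Omega x -> phi x = 0 }.

Definition sup_norm (F : 'rV[R]_n -> 'rV[R]_n) : \bar R :=
  ereal_sup [set (enorm (F x))%:E | x in Omega].

Definition otime (T : \bar R) : set R := [set t | 0 < t /\ (t%:E < T)%E].

Definition ctime (T : \bar R) : set R := [set t | 0 <= t /\ (t%:E < T)%E].

(* u in C^{1,2}((0,T) x closure Omega). *)
Record C12 (T : \bar R) (u : R -> 'rV[R]_n -> R) : Prop := {
  C12_continuous : {within otime T `*` closure Omega,
    continuous (fun z : R * 'rV[R]_n => u z.1 z.2)};
  C12_derivable_t : forall t x, otime T t -> Omega x ->
    derivable (fun s => u s x) t 1;
  C12_derivable_x : forall t x i, otime T t -> Omega x ->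
    derivable (u t) x (basis_vec i);
  C12_derivable_xx : forall t x i j, otime T t -> Omega x ->
    derivable (partial j (u t)) x (basis_vec i);
  C12_continuous_t :
    extends_continuously (otime T `*` Omega) (otime T `*` closure Omega)
      (fun z : R * 'rV[R]_n => derive1 (fun s => u s z.2) z.1);
  C12_continuous_x :
    extends_continuously (otime T `*` Omega) (otime T `*` closure Omega)
      (fun z : R * 'rV[R]_n => grad (u z.1) z.2);
  C12_continuous_xx : forall i j,
    extends_continuously (otime T `*` Omega) (otime T `*` closure Omega)
      (fun z : R * 'rV[R]_n => partial i (partial j (u z.1)) z.2) }.

(* Classical solution on [0,T) of u_t - Delta u = |grad u|^p with zero
   Dirichlet data and initial value phi. *)
Record classical_solution (phi : 'rV[R]_n -> R) (T : \bar R)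
    (u : R -> 'rV[R]_n -> R) : Prop := {
  cs_time : (0 < T)%E;
  cs_C12 : C12 T u;
  cs_continuous : {within ctime T `*` closure Omega,
    continuous (fun z : R * 'rV[R]_n => u z.1 z.2)};
  cs_grad_continuous :
    extends_continuously (ctime T `*` Omega) (ctime T `*` closure Omega)
      (fun z : R * 'rV[R]_n => grad (u z.1) z.2);
  cs_equation : forall t x, otime T t -> Omega x ->
    derive1 (fun s => u s x) t - laplacian (u t) x = enorm (grad (u t) x) `^ p;
  cs_boundary : forall t x, otime T t -> frontier Omega x -> u t x = 0;
  cs_initial : forall x, Omega x -> u 0 x = phi x }.

(* T is the existence time T*(phi).  The blow-up alternative is part of the
   definition, as in the usual existence theorem for the problem. *)
Record maximal_solution (phi : 'rV[R]_n -> R) (T : \bar R)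
    (u : R -> 'rV[R]_n -> R) : Prop := {
  ms_solution : classical_solution phi T u;
  ms_maximal : forall T' v, classical_solution phi T' v -> (T' <= T)%E;
  ms_blowup : forall Ts : R, T = Ts%:E ->
    (fun t : R => sup_norm (grad (u t))) @ Ts^'- --> +oo%E }.

End viscous_hamilton_jacobi.

(* Main.v *)
(* Let B be n times the sup norm of the gradient of u at time t0.  Two facts
   turn this into a bound on a time interval of length c B^(2 - p).

   (i) By the comparison principle applied to u and its time translates, u is
   Lipschitz in time up to the blow-up time T.  With a barrier of slope between
   3 B and 4 B in a layer of width ~ B^(1 - p) outside an exterior ball, this
   gives |u t x| <= L dist(x, boundary) with L ~ B as long as the increase in
   time, at most K (t - t0), stays below the size ~ B^(2 - p) of the barrier at
   the inner edge of the layer.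

   (ii) Comparing u with its space translates, whose boundary values are
   controlled by (i), shows that u t is L-Lipschitz; no equation for the
   gradient is needed.

   As the gradient blows up at T, the interval cannot reach T, so
   T - t0 >= c B^(2 - p), which is the claim. *)
Require Import Defs.
From HB Require Import structures.
From mathcomp Require Import all_boot all_order all_algebra.
From mathcomp Require Import all_classical all_reals all_analysis.
From mathcomp Require Import ring lra.

Import Order.TTheory GRing.Theory Num.Theory.
Import numFieldNormedType.Exports.

Local Open Scope classical_set_scope.
Local Open Scope ring_scope.

Set Implicit Arguments.
Unset Strict Implicit.
Unset Printing Implicit Defensive.

(** * One-variable calculus *)

(** The dimensions of the barrier are forced. With slope [4 B] at the boundary, absorbing the
    nonlinearity and the curvature of the ball takes a concavity [A] of order [B ^ p]; the slope
    stays comparable to [B] only while [A * eta <= B]. This fixes the width [eta], and with it the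
    height [B * eta] that the growth in time may use up. The rate comes out because [K] is the same
    for every [t0]: it bounds the time derivative on a fixed middle part of (0, T), and comparison
    carries the bound forward to T.

    Two obstacles shape the rest. The domain may be nonconvex, so a gradient bound says nothing
    directly about a segment that leaves it; the zero boundary values repair this, each end of the
    segment being estimated up to a point where the segment leaves the domain. And the given
    derivatives are partial ones, so increments are estimated coordinate by coordinate; the
    resulting factors [n] end up in [C1]. *)

Lemma derivable_lineE (R : realType) (V : normedModType R) (f : V -> R)
    (x v : V) (s : R) :
  derivable (fun r : R => f (x + r *: v)) s 1 = derivable f (x + s *: v) v.
Proof.
rewrite /derivable; set g1 := fun h => h^-1 *: _; set g2 := fun h => h^-1 *: _.
suff -> : g1 = g2 by []; apply/funext => h; rewrite /g1 /g2 /=.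
by rewrite [h%:A]mulr1 scalerDl addrCA.
Qed.

Lemma derive_lineE (R : realType) (V : normedModType R) (f : V -> R)
    (x v : V) (s : R) :
  'D_1 (fun r : R => f (x + r *: v)) s = 'D_v f (x + s *: v).
Proof.
rewrite /derive; set g1 := fun h => h^-1 *: _; set g2 := fun h => h^-1 *: _.
suff -> : g1 = g2 by []; apply/funext => h; rewrite /g1 /g2 /=.
by rewrite [h%:A]mulr1 scalerDl addrCA.
Qed.

Lemma derive_gt0_quotient (R : realType) (f : R -> R) (t : R) :
  derivable f t 1 -> 0 < 'D_1 f t ->
  exists2 d, 0 < d & forall h, h != 0 -> `|h| < d -> 0 < (f (t + h) - f t) / h.
Proof.
move=> df D0; have /cvgr_gt/(_ _ D0) := df; case=> d /= d0 Hd.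
exists d => // h h0 hd.
have := Hd h; rewrite /ball /= sub0r normrN => /(_ hd h0) /=.
by rewrite [h%:A]mulr1 [h + t]addrC [_ *: _]mulrC.
Qed.

(** Only times up to [t] are compared, because the maximum in the comparison principle may sit at
    the final time. *)
Lemma derive_ge0_left_max (R : realType) (f : R -> R) (t d : R) :
  0 < d -> derivable f t 1 -> (forall s, t - d < s -> s <= t -> f s <= f t) ->
  0 <= 'D_1 f t.
Proof.
move=> d0 df fmax; rewrite leNgt; apply/negP => Dlt.
have [e e0 He] : exists2 e, 0 < e &
    forall h, h != 0 -> `|h| < e -> 0 < ((- f) (t + h) - (- f) t) / h.
  by apply: derive_gt0_quotient; [exact: derivableN|rewrite deriveN// oppr_gt0].
pose h := Num.min d e / 2.
have hgt0 : 0 < h by rewrite divr_gt0// lt_min d0.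
have hm : h < Num.min d e by rewrite /h ltr_pdivrMr// ltr_pMr ?lt_min ?d0 ?e0// ltrDl.
have /andP[hd he] : (h < d) && (h < e) by rewrite -lt_min.
have := He (- h); rewrite oppr_eq0 gt_eqF// normrN gtr0_norm// => /(_ isT he).
rewrite nmulr_lgt0 ?invr_lt0 ?oppr_lt0//.
have -> : (- f) (t - h) - (- f) t = f t - f (t - h) by rewrite opprK addrC.
by rewrite subr_lt0 ltNge fmax//; lra.
Qed.

(** If [f2 > 0], then [f1], which vanishes at [t], is positive just to the right of [t], and the
    mean value theorem lifts [f] above its maximum. *)
Lemma derive2_le0_max (R : realType) (f f1 : R -> R) (t d f2 : R) :
  0 < d -> (forall s, `|s - t| < d -> is_derive s 1 f (f1 s)) ->
  is_derive t 1 f1 f2 -> (forall s, `|s - t| < d -> f s <= f t) ->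
  f1 t = 0 /\ f2 <= 0.
Proof.
move=> d0 df ddf fmax.
have inside s : s \in `](t - d), (t + d)[%R -> `|s - t| < d.
  by rewrite in_itv/= ltr_norml => /andP[? ?]; apply/andP; split; lra.
have ft0 : f1 t = 0.
  have tt : `|t - t| < d by rewrite subrr normr0.
  rewrite -(@derive_val _ _ _ _ _ _ _ (df t tt)).
  apply: derive_val; apply: (@derive1_at_max _ f (t - d) (t + d)).
  - lra.
  - by move=> s /inside /df/@ex_derive.
  - by rewrite in_itv/=; apply/andP; split; lra.
  - by move=> s /inside /fmax.
split=> //; rewrite leNgt; apply/negP => Dgt.
have [e e0 He] : exists2 e, 0 < e &
    forall h, h != 0 -> `|h| < e -> 0 < (f1 (t + h) - f1 t) / h.
  by apply: derive_gt0_quotient; [exact: ex_derive|rewrite derive_val].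
pose h := Num.min d e / 2.
have hgt0 : 0 < h by rewrite divr_gt0// lt_min d0.
have hm : h < Num.min d e.
  by rewrite /h ltr_pdivrMr// ltr_pMr ?lt_min ?d0 ?e0// ltrDl.
have /andP[hd he] : (h < d) && (h < e) by rewrite -lt_min.
have near_t s : s \in `[t, t + h]%R -> `|s - t| < d.
  by rewrite in_itv/= ltr_norml => /andP[? ?]; apply/andP; split; lra.
have [|||c] := @MVT _ f f1 t (t + h); first lra.
- by move=> s /subset_itv_oo_cc/near_t/df.
- by apply: derivable_within_continuous => s /near_t/df/@ex_derive.
rewrite in_itv/= => /andP[tc cth] fE.
have := He (c - t); rewrite subr_eq0 gt_eqF// gtr0_norm ?subr_gt0// => /(_ isT).
have -> : t + (c - t) = c by ring.
rewrite ft0 subr0 => /(_ _)/wrap[]; first lra.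
rewrite pmulr_lgt0 ?invr_gt0 ?subr_gt0// => fc.
have := fmax (t + h) (near_t _ _); rewrite in_itv/= lexx lerDl ltW// => /(_ isT).
by rewrite -subr_le0 fE leNgt mulr_gt0//; lra.
Qed.

Lemma mvt_affine (R : realType) (f : R -> R) (a e d : R) :
  (forall s, `|s| <= `|d| -> derivable f s 1 /\ `|'D_1 f s - a| <= e) ->
  `|f d - f 0 - a * d| <= e * `|d|.
Proof.
move=> H.
suff [c /H[_ De] ->] : exists2 c, `|c| <= `|d| & f d - f 0 = 'D_1 f c * d.
  by rewrite -mulrBl normrM ler_wpM2r.
have [d0|/ltW d0] := leP 0 d.
  have near0 s : s \in `[0, d]%R -> `|s| <= `|d|.
    by rewrite in_itv/= => /andP[? ?]; rewrite !ger0_norm.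
  have [||c /near0 cd] := @MVT_segment _ f ('D_1 f) 0 d d0.
  - by move=> s /subset_itv_oo_cc/near0/H[/derivableP].
  - by apply: derivable_within_continuous => s /near0/H[].
  - by rewrite subr0; exists c.
have near0 s : s \in `[d, 0]%R -> `|s| <= `|d|.
  by rewrite in_itv/= => /andP[? ?]; rewrite !ler0_norm ?lerN2.
have [||c /near0 cd fE] := @MVT_segment _ f ('D_1 f) d 0 d0.
- by move=> s /subset_itv_oo_cc/near0/H[/derivableP].
- by apply: derivable_within_continuous => s /near0/H[].
- by exists c => //; rewrite -opprB fE sub0r mulrN opprK.
Qed.

(** * Euclidean norm and coordinatewise mean value estimates *)

Section euclidean_norm.
Context {R : realType} {n : nat}.
Implicit Types v w : 'rV[R]_n.

Lemma enorm_ge0 v : 0 <= enorm v.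
Proof. exact: sqrtr_ge0. Qed.

Lemma enorm_sqr v : enorm v ^+ 2 = \sum_i v ord0 i ^+ 2.
Proof. by rewrite sqr_sqrtr// sumr_ge0// => i _; rewrite sqr_ge0. Qed.

Lemma enormZ a v : enorm (a *: v) = `|a| * enorm v.
Proof.
rewrite /enorm -sqrtr_sqr -sqrtrM ?sqr_ge0// mulr_sumr.
by congr Num.sqrt; apply: eq_bigr => i _; rewrite mxE exprMn.
Qed.

Lemma enormN v : enorm (- v) = enorm v.
Proof. by rewrite -scaleN1r enormZ normrN1 mul1r. Qed.

Lemma coord_le_enorm v i : `|v ord0 i| <= enorm v.
Proof.
rewrite -sqrtr_sqr ler_wsqrtr// (bigD1 i)//= lerDl.
by apply: sumr_ge0 => j _; rewrite sqr_ge0.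
Qed.

Lemma enorm_basis_vec i : enorm (basis_vec i : 'rV[R]_n) = 1.
Proof.
rewrite /enorm (bigD1 i)//= big1 ?addr0 => [|j ji].
  by rewrite mxE !eqxx expr1n sqrtr1.
by rewrite mxE eqxx (negbTE ji) expr0n.
Qed.

Lemma enorm_le_coord v (c : R) : 0 <= c -> (forall i, `|v ord0 i| <= c) ->
  enorm v <= n%:R * c.
Proof.
move=> c0 vc; rewrite -(@ler_pXn2r _ 2) ?nnegrE ?mulr_ge0 ?enorm_ge0//.
rewrite enorm_sqr (le_trans (y := \sum_(i < n) c ^+ 2))//.
  apply: ler_sum => i _; rewrite -real_normK ?num_real//.
  by rewrite ler_pXn2r ?nnegrE.
rewrite sumr_const card_ord exprMn -[leLHS]mulr_natl ler_wpM2r ?sqr_ge0//.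
by rewrite -natrX ler_nat; case: (n) => // m; rewrite leq_pmulr.
Qed.

Lemma mxnorm_le_enorm v : `|v| <= enorm v.
Proof.
rewrite /Num.norm/= mx_normrE; apply/bigmax_leP; split=> [|[i j] _]/=.
  exact: enorm_ge0.
by rewrite ord1 coord_le_enorm.
Qed.

Lemma coord_le_mxnorm v i : `|v ord0 i| <= `|v|.
Proof.
by rewrite [leRHS]/Num.norm/= mx_normrE; apply/bigmax_geP; right; exists (ord0, i).
Qed.

Lemma sum_coordM_le (a : 'I_n -> R) (e : R) v : (forall i, `|a i| <= e) ->
  `|\sum_i a i * v ord0 i| <= n%:R * e * enorm v.
Proof.
move=> ae; apply: le_trans (ler_norm_sum _ _ _) _.
apply: (le_trans (y := \sum_(i < n) e * enorm v)).
  by apply: ler_sum => i _; rewrite normrM ler_pM// coord_le_enorm.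
by rewrite sumr_const card_ord -[leLHS]mulr_natl mulrA.
Qed.

(* Moving from x to y one coordinate at a time stays in the box spanned by x
   and y, so bounds on the partial derivatives suffice: no total derivative is
   needed. *)
Lemma coord_telescope (f : 'rV[R]_n -> R) (x y : 'rV[R]_n) (a e : 'I_n -> R) :
  (forall (z : 'rV[R]_n) i, 
     (forall j, `|z ord0 j - x ord0 j| <= `|y ord0 j - x ord0 j|) ->
     derivable f z (basis_vec i) /\ `|partial i f z - a i| <= e i) ->
  `|f y - f x - \sum_i a i * (y ord0 i - x ord0 i)|
    <= \sum_i e i * `|y ord0 i - x ord0 i|.
Proof.
move=> H.
pose w k : 'rV[R]_n := \row_j if (j < k)%N then y ord0 j else x ord0 j.
have w0 : w 0%N = x by apply/rowP => j; rewrite mxE.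
have wn : w n = y by apply/rowP => j; rewrite mxE ltn_ord.
have -> : f y - f x = \sum_(i < n) (f (w i.+1) - f (w i)).
  rewrite -(big_mkord xpredT (fun i => f (w i.+1) - f (w i))).
  by rewrite telescope_sumr// w0 wn.
rewrite -sumrB; apply: le_trans (ler_norm_sum _ _ _) _.
apply: ler_sum => i _.
have wS : w i.+1 = w i + (y ord0 i - x ord0 i) *: basis_vec i.
  apply/rowP => j; rewrite !mxE eqxx/= ltnS leq_eqVlt -val_eqE/=.
  case: (ltngtP j i) => ji; rewrite ?mulr0 ?addr0//.
  by rewrite (val_inj ji) mulr1 addrC subrK.
have := @mvt_affine _ (fun r : R => f (w i + r *: basis_vec i)) (a i) (e i)
  (y ord0 i - x ord0 i).
rewrite scale0r addr0 -wS; apply => s sd.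
rewrite derivable_lineE derive_lineE; apply: H => j; rewrite !mxE eqxx/=.
rewrite -val_eqE/=; case: (ltngtP j i) => ji; rewrite ?mulr0 ?mulr1 ?addr0//.
- by rewrite subrr normr0.
- by rewrite (val_inj ji) addrC addrK.
Qed.

End euclidean_norm.

(** * Comparison principle *)

Section comparison_principle.
Context {R : realType} {n : nat}.
Implicit Types (u f g : R -> 'rV[R]_n -> R) (t : R) (x : 'rV[R]_n).

Definition regular_at u t x : Prop :=
  [/\ derivable (fun s => u s x) t 1,
      forall i, derivable (u t) x (basis_vec i)
    & forall i, derivable (partial i (u t)) x (basis_vec i)].

Definition heat_residual (F : 'rV[R]_n -> R) u t x : R :=
  derive1 (fun s => u s x) t - laplacian (u t) x - F (grad (u t) x).

Lemma time_derivative_gap (a b : R -> R) (t0 s eps : R) : t0 < s ->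
  derivable a s 1 -> derivable b s 1 ->
  (forall r, t0 < r -> r <= s ->
    a r - b r - eps * (r - t0) <= a s - b s - eps * (s - t0)) ->
  eps <= 'D_1 a s - 'D_1 b s.
Proof.
move=> t0s da db absup.
pose lin (r : R) := eps * (r - t0).
have dlin : is_derive s 1 lin eps.
  have -> : lin = eps *: (id - cst t0) by apply/funext.
  by apply: is_derive_eq; rewrite subr0 [_ *: _]mulr1.
have dab := is_deriveB (is_deriveB (derivableP da) (derivableP db)) dlin.
rewrite -subr_ge0 -(@derive_val _ _ _ _ _ _ _ dab).
apply: (@derive_ge0_left_max _ _ _ (s - t0)); first by rewrite subr_gt0.
  exact: ex_derive.
by move=> r; rewrite opprB addrC subrK; exact: absup.
Qed.

Lemma open_line_nbhs (D : set 'rV[R]_n) x : open D -> D x ->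
  exists2 d : R, 0 < d &
    forall i (r : R), `|r| < d -> D (x + r *: basis_vec i).
Proof.
rewrite openE => oD /oD /nbhs_ballP[d/= d0 xD]; exists d => // i r rd.
apply: xD; rewrite -ball_normE/= opprD addNKr normrN.
by rewrite (le_lt_trans (mxnorm_le_enorm _))// enormZ enorm_basis_vec mulr1.
Qed.

(** On each coordinate line through [x] the difference has a maximum at parameter 0, so the
    one-variable test applies to the pure second derivatives. *)
Lemma space_max (D : set 'rV[R]_n) f g t x : open D -> D x ->
  (forall y, D y -> regular_at f t y) -> (forall y, D y -> regular_at g t y) ->
  (forall y, D y -> f t y - g t y <= f t x - g t x) ->
  grad (f t) x = grad (g t) x /\ laplacian (f t) x <= laplacian (g t) x.
Proof.
move=> oD Dx fr gr xmax.
have [d d0 xD] := open_line_nbhs oD Dx.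
suff H i : partial i (f t) x - partial i (g t) x = 0 /\
    partial i (partial i (f t)) x - partial i (partial i (g t)) x <= 0.
  split.
    by apply/rowP => i; rewrite !mxE; apply/eqP; rewrite -subr_eq0 (H i).1.
  by apply: ler_sum => i _; rewrite -subr_le0; exact: (H i).2.
pose line (h : 'rV[R]_n -> R) (r : R) := h (x + r *: basis_vec i).
have lineD h r : derivable h (x + r *: basis_vec i) (basis_vec i) ->
    is_derive r 1 (line h) (line (partial i h) r).
  by move=> dh; apply: DeriveDef; rewrite /line ?derivable_lineE ?derive_lineE.
have x0 : x + 0 *: basis_vec i = x by rewrite scale0r addr0.
have line0 h : line h 0 = h x by rewrite /line x0.
have dB r : D (x + r *: basis_vec i) -> is_derive r 1 (line (f t) - line (g t))
    (line (partial i (f t)) r - line (partial i (g t)) r).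
  move=> rD; have [_ dft _] := fr _ rD; have [_ dgt _] := gr _ rD.
  exact: (is_deriveB (lineD _ _ (dft i)) (lineD _ _ (dgt i))).
have ddB : is_derive (0 : R) 1 (line (partial i (f t)) - line (partial i (g t)))
    (line (partial i (partial i (f t))) 0 - line (partial i (partial i (g t))) 0).
  have [_ _ dft] := fr _ Dx; have [_ _ dgt] := gr _ Dx.
  have dft0 := lineD (partial i (f t)) 0; have dgt0 := lineD (partial i (g t)) 0.
  rewrite x0 in dft0 dgt0.
  exact: (is_deriveB (dft0 (dft i)) (dgt0 (dgt i))).
rewrite -!line0.
apply: (derive2_le0_max d0 _ ddB) => r; rewrite subr0 => /(xD i).
  exact: dB.
by move=> /xmax; rewrite -[f t x]line0 -[g t x]line0.
Qed.

Lemma bounded_subset (A B : set 'rV[R]_n) :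
  A `<=` B -> bounded_set B -> bounded_set A.
Proof. by move=> AB [M [Mr BM]]; exists M; split=> // r Mr' y /AB; exact: BM. Qed.

Lemma bounded_closure (A : set 'rV[R]_n) : bounded_set A -> bounded_set (closure A).
Proof.
move=> [M [Mr AM]]; exists M; split=> // r Mr' y.
have cB : closed [set z : 'rV[R]_n | `|z| <= r].
  apply: (@closed_comp _ _ (fun z : 'rV[R]_n => `|z|) [set s | s <= r]).
    by move=> z _; exact: norm_continuous.
  exact: closed_le.
by move/(closureS (AM r Mr')); rewrite -(closure_id _).1.
Qed.

(* At an interior maximum of f - g - eps (t - t0) the gradients of f and g
   agree, so the nonlinearity F cancels and needs no assumption. *)
Lemma comparison (F : 'rV[R]_n -> R) (D : set 'rV[R]_n) (t0 t1 : R) f g :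
  open D -> bounded_set D ->
  {within `[t0, t1] `*` closure D,
    continuous (fun z : R * 'rV[R]_n => f z.1 z.2 - g z.1 z.2)} ->
  (forall t x, t0 < t <= t1 -> D x -> regular_at f t x) ->
  (forall t x, t0 < t <= t1 -> D x -> regular_at g t x) ->
  (forall t x, t0 < t <= t1 -> D x ->
    heat_residual F f t x <= heat_residual F g t x) ->
  (forall x, closure D x -> f t0 x <= g t0 x) ->
  (forall t x, t0 <= t <= t1 -> closure D x -> ~ D x -> f t x <= g t x) ->
  forall t x, t0 <= t <= t1 -> closure D x -> f t x <= g t x.
Proof.
move=> oD bD cfg fr gr fg init bdry t x tt Dx.
rewrite leNgt; apply/negP; rewrite -subr_gt0 => m0.
set m := f t x - g t x in m0.
(* Small enough that the penalty over the whole interval stays below [m]; the [+ 1] covers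
   [t1 = t0]. *)
pose eps := m / (2 * (t1 - t0 + 1)).
have t01 : 0 < t1 - t0 + 1 by lra.
have eps0 : 0 < eps by rewrite divr_gt0// mulr_gt0.
have epsm : eps * (t1 - t0) < m.
  rewrite /eps -mulrA gtr_pMr// mulrC ltr_pdivrMr ?mulr_gt0//; lra.
pose K := `[t0, t1] `*` closure D.
pose phi (z : R * 'rV[R]_n) := f z.1 z.2 - g z.1 z.2 - eps * (z.1 - t0).
have cK : compact K.
  apply: compact_setX; first exact: segment_compact.
  apply: bounded_closed_compact; last exact: closed_closure.
  exact: bounded_closure.
have phic : {within K, continuous phi}.
  have clin : continuous (fun z : R * 'rV[R]_n => eps * (z.1 - t0)).
    move=> z; apply: cvgM; first exact: cvg_cst.
    by apply: cvgB; [exact: cvg_fst|exact: cvg_cst].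
  move=> z; apply: (@cvgB _ _ (subspace K)); first exact: cfg.
  exact: (continuous_subspaceT clin).
have Ktx : K (t, x) by split => //=; rewrite in_itv.
have [[s y] + ymax] := compact_EVT_max (ex_intro _ _ Ktx) cK phic.
rewrite inE /K/= => -[/=]; rewrite in_itv/= => st Dy.
have maxK r z : t0 <= r <= t1 -> closure D z -> phi (r, z) <= phi (s, y).
  by move=> rt Dz; apply: ymax; rewrite inE; split => //=; rewrite in_itv.
(* Positivity keeps the maximum point off the initial and lateral boundary, where [f <= g]. *)
have fgpos : 0 < f s y - g s y.
  have := maxK _ _ tt Dx; rewrite /phi/= -/m => mle.
  have : eps * (t - t0) <= eps * (t1 - t0) by apply: ler_wpM2l; [exact: ltW|lra].
  have : 0 <= eps * (s - t0) by apply: mulr_ge0; [exact: ltW|lra].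
  lra.
have DDy : D y.
  by apply/not_notP => nDy; have := bdry s y st Dy nDy; lra.
have t0s : t0 < s <= t1.
  case/andP: st => t0s ->; rewrite andbT lt_def t0s andbT; apply/eqP => st0.
  by have := init y Dy; rewrite -st0; lra.
have [dft _ _] := fr _ _ t0s DDy; have [dgt _ _] := gr _ _ t0s DDy.
have [|gradE lapE] :=
  space_max oD DDy (fun z => fr s z t0s) (fun z => gr s z t0s).
  move=> z Dz; have := maxK s z st (subset_closure Dz).
  by rewrite /phi/= lerD2r.
(* With equal gradients the residual inequality bounds the difference of time derivatives by the
   difference of Laplacians, hence by 0, while maximality in time makes it at least [eps]. *)
have := fg _ _ t0s DDy; rewrite /heat_residual gradE !derive1E.
have := time_derivative_gap (proj1 (andP t0s)) dft dgt _.
have maxt r : t0 < r -> r <= s -> f r y - g r y - eps * (r - t0)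
    <= f s y - g s y - eps * (s - t0).
  by move=> rs1 rs2; apply: (maxK r y) => //; case/andP: t0s => _ /(le_trans rs2);
    rewrite (ltW rs1).
move=> /(_ _ maxt); clear -eps0 lapE.
move: ('D_1 _ s) ('D_1 _ s) (laplacian _ _) (laplacian _ _) lapE (F _) => *.
lra.
Qed.

End comparison_principle.

(** * Lipschitz bounds on nonconvex domains *)

Lemma continuous_within_comp (T U V : topologicalType) (A : set U) (B : set T)
    (f : U -> V) (g : T -> U) :
  continuous g -> (forall x, B x -> A (g x)) ->
  {within A, continuous f} -> {within B, continuous (fun x => f (g x))}.
Proof.
move=> cg gBA /subspace_continuousP cf; apply/subspace_continuousP => x Bx.
apply: (@cvg_comp _ _ _ g f _ (within A (nbhs (g x))) _ _ (cf _ (gBA _ Bx))).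
move=> W WA; have : \forall y \near x, A (g y) -> W (g y).
  exact: (cg x [set z | A z -> W z]).
by apply: (@filterS _ (nbhs x)) => y gWy By; apply: gWy; exact: gBA.
Qed.

Lemma continuous_slice (U V : topologicalType) (a : U) :
  continuous (fun z : V => (a, z)).
Proof. by move=> z; exact: (cvg_pair (cvg_cst a) cvg_id). Qed.

Lemma continuous_withinB (U : topologicalType) (R : realType) (A : set U)
    (f g : U -> R) :
  {within A, continuous f} -> {within A, continuous g} ->
  {within A, continuous (fun z => f z - g z)}.
Proof. by move=> cf cg z; apply: (@cvgB _ _ (subspace A)); [exact: cf|exact: cg]. Qed.

Section lipschitz_on_domain.
Context {R : realType} {n : nat}.
Implicit Types (f : 'rV[R]_n -> R) (x y v : 'rV[R]_n) (Om : set 'rV[R]_n).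

Lemma mxnorm_le_coord v (c : R) : 0 <= c -> (forall i, `|v ord0 i| <= c) ->
  `|v| <= c.
Proof.
move=> c0 vc; rewrite /Num.norm/= mx_normrE; apply/bigmax_leP.
by split=> // -[i j] _ /=; rewrite ord1.
Qed.

(** The mean value theorem along an oblique segment needs directional derivatives. They come from
    the partial ones, continuous at [x], by applying [coord_telescope] on small boxes. *)
Lemma is_derive_grad Om f x v : open Om -> Om x ->
  (forall y i, Om y -> derivable f y (basis_vec i)) ->
  (forall i, partial i f y @[y --> x] --> partial i f x) ->
  is_derive x v f (\sum_i partial i f x * v ord0 i).
Proof.
move=> oOm Omx df cf; set L := \sum_i _.
have : h^-1 *: ((f \o shift x) (h *: v) - f x) @[h --> (0 : R)^'] --> L.
  apply/cvgrPdist_le => e e0.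
  (* The telescoped error is at most [e' * n * |v|] per unit of [h]; the [+ 1] covers [v = 0]. *)
  pose e' := e / (n%:R * `|v| + 1).
  have c0 : 0 < n%:R * `|v| + 1 by rewrite ltr_wpDl// mulr_ge0.
  have e'0 : 0 < e' by rewrite divr_gt0.
  have : \forall y \near x, Om y /\ forall i, `|partial i f x - partial i f y| <= e'.
    near=> y; split; first by near: y; exact: open_nbhs_nbhs.
    near: y; apply: filter_forall => i.
    by have /cvgrPdist_le/(_ _ e'0) := cf i.
  move=> /nbhs_ballP[d/= d0 xd].
  have hd : \forall h \near (0 : R)^', `|h| * `|v| < d.
    have : (fun h : R => `|h| * `|v|) @ 0^' --> `|0 : R| * `|v|.
      apply: cvgMl; apply: cvg_norm; exact: cvg_within.
    by rewrite normr0 mul0r => /cvgr_lt; apply.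
  near=> h.
  have h0 : h != 0 by near: h; exact: nbhs_dnbhs_neq.
  have hvd : `|h| * `|v| < d by near: h.
  have tel : `|f (h *: v + x) - f x - \sum_i partial i f x * (h * v ord0 i)|
      <= \sum_(i < n) e' * `|h * v ord0 i|.
    have E i : (h *: v + x) ord0 i - x ord0 i = h * v ord0 i.
      by rewrite !mxE addrK.
    have -> : \sum_i partial i f x * (h * v ord0 i) =
        \sum_i partial i f x * ((h *: v + x) ord0 i - x ord0 i).
      by apply: eq_bigr => i _; rewrite E.
    have -> : \sum_(i < n) e' * `|h * v ord0 i| =
        \sum_(i < n) e' * `|(h *: v + x) ord0 i - x ord0 i|.
      by apply: eq_bigr => i _; rewrite E.
    apply: coord_telescope => z i zx.
    have /xd[Omz zi] : ball x d z.
      rewrite -ball_normE/= distrC (le_lt_trans _ hvd)//.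
      apply: mxnorm_le_coord => [|j]; first by rewrite mulr_ge0.
      rewrite !mxE; apply: le_trans (zx j) _.
      by rewrite E normrM ler_wpM2l// coord_le_mxnorm.
    by split; [exact: df|rewrite distrC].
  have -> : L - h^-1 *: ((f \o shift x) (h *: v) - f x) =
      - h^-1 * (f (h *: v + x) - f x - \sum_i partial i f x * (h * v ord0 i)).
    rewrite [_ *: _]/(_ * _)/= mulNr mulrBr opprB; congr (_ - _).
    rewrite /L mulr_sumr; apply: eq_bigr => i _.
    by rewrite mulrCA [h^-1 * _]mulrA mulVf// mul1r.
  rewrite normrM normrN normfV mulrC ler_pdivrMr ?normr_gt0//.
  apply: le_trans tel _.
  apply: (@le_trans _ _ (\sum_(i < n) e' * (`|h| * `|v|))).
    apply: ler_sum => i _; rewrite normrM !ler_wpM2l ?(ltW e'0)//.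
    exact: coord_le_mxnorm.
  rewrite sumr_const card_ord.
  have -> : e' * (`|h| * `|v|) *+ n = e' * (n%:R * `|v|) * `|h|.
    by rewrite -mulr_natl; ring.
  apply: ler_wpM2r => //; rewrite /e' -mulrA ler_piMr ?(ltW e0)//.
  by rewrite mulrC ler_pdivrMr// mul1r lerDl.
move=> Lcvg; apply: DeriveDef.
  by apply/cvg_ex; exists L.
exact/cvg_lim.
Unshelve. all: by end_near. Qed.

(** The end points may lie on the frontier: the mean value theorem uses derivatives on the open
    segment and continuity on the closed one. *)
Lemma lipschitz_segment Om f (M : R) x y : open Om ->
  {within closure Om, continuous f} ->
  (forall z i, Om z -> derivable f z (basis_vec i)) ->
  (forall z i, Om z -> partial i f y @[y --> z] --> partial i f z) ->
  (forall z i, Om z -> `|partial i f z| <= M) ->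
  closure Om x -> closure Om y ->
  (forall s : R, 0 < s < 1 -> Om (x + s *: (y - x))) ->
  `|f y - f x| <= n%:R * M * enorm (y - x).
Proof.
move=> oOm cf df cdf fM clx cly seg.
pose g (s : R) := f (x + s *: (y - x)).
pose g1 (s : R) := \sum_i partial i f (x + s *: (y - x)) * (y - x) ord0 i.
have x0 : x + 0 *: (y - x) = x by rewrite scale0r addr0.
have x1 : x + 1 *: (y - x) = y by rewrite scale1r addrC subrK.
have [|||c] := @MVT _ g g1 0 1; first exact: ltr01.
- move=> s /=; rewrite in_itv/= => /seg sOm.
  have dv := is_derive_grad (y - x) oOm sOm df (fun i => cdf _ i sOm).
  apply: DeriveDef; first by rewrite derivable_lineE; exact: ex_derive.
  by rewrite derive_lineE; exact: derive_val.
- apply: (@continuous_within_comp _ _ _ (closure Om) _ f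
    (fun s : R => x + s *: (y - x))) => //.
    move=> s; apply: cvgD; first exact: cvg_cst.
    by apply: cvgZ; [exact: cvg_id|exact: cvg_cst].
  move=> s /=; rewrite in_itv/= => /andP[s0 s1].
  have [->|sn0] := eqVneq s 0; first by rewrite x0.
  have [->|sn1] := eqVneq s 1; first by rewrite x1.
  by apply/subset_closure/seg; rewrite !lt_neqAle eq_sym sn0 sn1 s0 s1.
rewrite in_itv/= => /seg cOm; rewrite /g x0 x1 subr0 mulr1 => ->.
by apply: sum_coordM_le => i; exact: fM.
Qed.

(** The exit parameter is the least element of the compact set of parameters in [0, 1] whose points
    lie outside [Om]. *)
Lemma first_exit Om x w : open Om -> Om x -> ~ Om w ->
  exists s : R, [/\ 0 < s <= 1, frontier Om (x + s *: (w - x))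
    & forall r, 0 <= r < s -> Om (x + r *: (w - x))].
Proof.
move=> oOm Omx Omw.
pose gam (s : R) := x + s *: (w - x).
have cgam : continuous gam.
  move=> s; apply: cvgD; first exact: cvg_cst.
  by apply: cvgZ; [exact: cvg_id|exact: cvg_cst].
have gam0 : gam 0 = x by rewrite /gam scale0r addr0.
have gam1 : gam 1 = w by rewrite /gam scale1r addrC subrK.
pose S := `[(0 : R), 1] `&` gam @^-1` (~` Om).
have cS : compact S.
  apply: (@subclosed_compact _ _ `[(0 : R), 1]); last by move=> ? [].
  - apply: closedI; first exact: itv_closed.
    by apply: preimage_closed => [s _|]; [exact: cgam|exact: open_closedC].
  - exact: segment_compact.
have S1 : S 1 by split; rewrite /= ?in_itv/= ?ler01 ?lexx// gam1.
have [s + smin] := compact_EVT_min (ex_intro _ _ S1) cS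
  (continuous_subspaceT (fun s : R => @cvg_id _ (nbhs s))).
rewrite inE => -[/=]; rewrite in_itv/= => /andP[s0 s1] nOms.
have sgt0 : 0 < s.
  by rewrite lt_neqAle s0 andbT; apply/eqP => s0'; rewrite -s0' gam0 in nOms.
have before r : 0 <= r < s -> Om (gam r).
  move=> /andP[r0 rs]; apply: contrapT => nOmr.
  have : S r by split; rewrite //= in_itv/= r0 (le_trans (ltW rs)).
  by move/mem_set/smin; rewrite leNgt rs.
exists s; split; rewrite ?sgt0 ?s1//; split; last first.
  by rewrite (interior_id _).1.
move=> B /cgam [d/= d0 sB].
(* A parameter before [s] and within [d] of it: its point lies in [Om], which puts [gam s] in the
   closure. *)
pose r := Num.max 0 (s - d / 2).
have rs : r < s by rewrite gt_max sgt0/=; lra.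
have r0 : 0 <= r by rewrite le_max lexx.
exists (gam r); split; first by apply: before; rewrite r0.
apply: sB; rewrite /= ger0_norm ?subr_ge0 ?(ltW rs)//.
have : s - d / 2 <= r by rewrite le_max lexx orbT.
lra.
Qed.

Section lipschitz.
Variables (Om : set 'rV[R]_n) (f : 'rV[R]_n -> R) (M : R).
Hypotheses (oOm : open Om) (cf : {within closure Om, continuous f})
  (df : forall z i, Om z -> derivable f z (basis_vec i))
  (cdf : forall z i, Om z -> partial i f y @[y --> z] --> partial i f z)
  (fM : forall z i, Om z -> `|partial i f z| <= M)
  (M0 : 0 <= M) (f0 : forall x, frontier Om x -> f x = 0).

(* As f vanishes on the frontier, f x only depends on the part of the segment
   before its first exit from Om; convexity of Om is not needed. *)
Lemma lipschitz_exit x w : Om x -> ~ Om w ->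
  `|f x| <= n%:R * M * enorm (w - x).
Proof.
move=> Omx Omw.
have [s [/andP[s0 s1] fz before]] := first_exit oOm Omx Omw.
have -> : `|f x| = `|f (x + s *: (w - x)) - f x| by rewrite (f0 fz) sub0r normrN.
have E : x + s *: (w - x) - x = s *: (w - x) by rewrite addrC addKr.
apply: (@le_trans _ _ (n%:R * M * enorm (x + s *: (w - x) - x))).
  apply: (lipschitz_segment oOm) => //; first exact: subset_closure.
    by case: fz.
  move=> r /andP[r0 r1]; rewrite E scalerA; apply: before.
  by rewrite mulr_ge0 ?(ltW r0) ?(ltW s0)//= gtr_pMl.
rewrite E enormZ; apply: ler_wpM2l; first by rewrite mulr_ge0.
by rewrite ler_piMl ?enorm_ge0// gtr0_norm.
Qed.

(** If the segment leaves [Om], pick a point of it outside [Om]. By [lipschitz_exit] both values are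
    controlled by the distances to that point, and these add up to the length of the segment. *)
Lemma lipschitz_closure x y : closure Om x -> closure Om y ->
  `|f y - f x| <= n%:R * M * enorm (y - x).
Proof.
move=> clx cly.
have bnd z : closure Om z -> ~ Om z -> f z = 0.
  by move=> ? ?; apply: f0; split; rewrite ?(interior_id _).1.
have [Omx|Omx] := pselect (Om x); last first.
  rewrite (bnd x)// subr0.
  have [Omy|Omy] := pselect (Om y).
    by rewrite -enormN opprB; exact: lipschitz_exit.
  by rewrite (bnd y)// normr0 !mulr_ge0// enorm_ge0.
have [Omy|Omy] := pselect (Om y); last first.
  by rewrite (bnd y)// sub0r normrN; exact: lipschitz_exit.
have [seg|] := pselect (forall s : R, 0 < s < 1 -> Om (x + s *: (y - x))).
  exact: (lipschitz_segment oOm).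
move=> /existsNP[s /not_implyP[/andP[s0 s1] nOm]].
have fx := lipschitz_exit Omx nOm; have fy := lipschitz_exit Omy nOm.
have Ex : x + s *: (y - x) - x = s *: (y - x) by rewrite addrC addKr.
have Ey : x + s *: (y - x) - y = (s - 1) *: (y - x).
  by apply/rowP => j; rewrite !mxE; ring.
rewrite Ex enormZ (gtr0_norm s0) in fx.
have s10 : s - 1 < 0 by rewrite subr_lt0.
rewrite Ey enormZ (ltr0_norm s10) in fy.
apply: le_trans (ler_normB _ _) _.
apply: le_trans (lerD fy fx) _.
by rewrite -mulrDr -mulrDl opprB subrK mul1r.
Qed.

End lipschitz.
End lipschitz_on_domain.

(** * Uniform exterior ball condition *)

Section exterior_ball_condition.
Context {R : realType} {n : nat}.
Implicit Types (f rho : 'rV[R]_n -> R) (x y v c : 'rV[R]_n) (Om : set 'rV[R]_n).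

(** The radius is an argument so that a single one can serve the whole frontier. *)
Definition exterior_ball Om (r : R) x : Prop :=
  exists2 c, enorm (x - c) = r & forall y, Om y -> r < enorm (y - c).

Lemma frontier_notin Om x : open Om -> frontier Om x -> ~ Om x.
Proof. by move=> oOm [_]; rewrite (interior_id _).1. Qed.

Lemma term_le_sum (F : 'I_n -> R) : (forall i, 0 <= F i) ->
  forall i, F i <= \sum_j F j.
Proof.
move=> F0 i; rewrite (bigD1 i)//= lerDl.
by apply: sumr_ge0 => j _; exact: F0.
Qed.

Lemma lipschitz_partials f x y (C : R) : 0 <= C ->
  (forall z, `|z - x| <= `|y - x| -> forall i,
     derivable f z (basis_vec i) /\ `|partial i f z| <= C) ->
  `|f y - f x| <= n%:R * C * `|y - x|.
Proof.
move=> C0 H.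
have := @coord_telescope _ _ f x y (fun=> 0) (fun=> C).
rewrite big1 ?subr0 => [tel|i _]; last by rewrite mul0r.
apply: le_trans (tel _) _ => [z i zx|].
  rewrite subr0; apply: H; apply: mxnorm_le_coord => // j.
  rewrite !mxE; apply: le_trans (zx j) _.
  by have := coord_le_mxnorm (y - x) j; rewrite !mxE.
apply: (@le_trans _ _ (\sum_(i < n) C * `|y - x|)).
  apply: ler_sum => i _; apply: ler_wpM2l => //.
  by have := coord_le_mxnorm (y - x) i; rewrite !mxE.
by rewrite sumr_const card_ord -[leLHS]mulr_natl mulrA.
Qed.

(** On the box spanned by [x] and [y] each partial derivative stays within [n * C * |y - x|] of its
    value at [x]; [coord_telescope] turns this into a first-order expansion with quadratic
    remainder. *)
Lemma quadratic_lower_bound rho x y (C : R) : 0 <= C ->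
  (forall z, `|z - x| <= `|y - x| -> forall i,
     derivable rho z (basis_vec i) /\
     forall j, derivable (partial i rho) z (basis_vec j) /\
        `|partial j (partial i rho) z| <= C) ->
  rho x + \sum_i partial i rho x * (y ord0 i - x ord0 i)
     - n%:R ^+ 2 * C * enorm (y - x) ^+ 2 <= rho y.
Proof.
move=> C0 H.
have box (z : 'rV[R]_n) : (forall j, `|z ord0 j - x ord0 j| <= `|y ord0 j - x ord0 j|) ->
    `|z - x| <= `|y - x|.
  move=> zx; apply: mxnorm_le_coord => // j; rewrite !mxE.
  by apply: le_trans (zx j) _; have := coord_le_mxnorm (y - x) j; rewrite !mxE.
have := @coord_telescope _ _ rho x y (fun i => partial i rho x)
  (fun=> n%:R * C * `|y - x|).
move=> /(_ _)/wrap[z i /box zx|].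
  have [dz _] := H z zx i; split=> //.
  apply: (le_trans (lipschitz_partials C0 _)) => [w wz j|].
    by have [_ /(_ j)] := H w (le_trans wz zx) i.
  by apply: ler_wpM2l; rewrite ?mulr_ge0.
move=> tel.
have : \sum_(i < n) n%:R * C * `|y - x| * `|y ord0 i - x ord0 i|
    <= n%:R ^+ 2 * C * enorm (y - x) ^+ 2.
  apply: (@le_trans _ _ (\sum_(i < n) n%:R * C * enorm (y - x) ^+ 2)).
    apply: ler_sum => i _; rewrite -mulrA; apply: ler_wpM2l.
      by rewrite mulr_ge0.
    rewrite expr2; apply: ler_pM => //; first exact: mxnorm_le_enorm.
    by have := coord_le_enorm (y - x) i; rewrite !mxE.
  by rewrite sumr_const card_ord -[leLHS]mulr_natl; nra.
move: tel; rewrite ler_norml => /andP[+ _].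
lra.
Qed.

(* The ball of radius r touching at x from outside is {y | |v|^2 <= 2 r nu.v}
   with v = y - x, and there the linear term of rho dominates the quadratic
   remainder. *)
Lemma exterior_ball_criterion Om rho x (m C r d : R) :
  0 < m -> 0 <= C -> 0 < r -> n%:R ^+ 2 * C <= m / (2 * r) -> 2 * r < d ->
  0 <= rho x -> m <= enorm (grad rho x) ->
  (forall y, `|y - x| < d -> Om y -> rho y < 0) ->
  (forall y, `|y - x| < d -> forall i,
     derivable rho y (basis_vec i) /\
     forall j, derivable (partial i rho) y (basis_vec j) /\
        `|partial j (partial i rho) y| <= C) ->
  exterior_ball Om r x.
Proof.
move=> m0 C0 r0 rC rd rhox gm Omrho H.
set g := grad rho x in gm *.
have g0 : 0 < enorm g by exact: lt_le_trans gm.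
pose nu := (enorm g)^-1 *: g.
have nu1 : enorm nu = 1.
  by rewrite enormZ normfV gtr0_norm// mulVf// gt_eqF.
exists (x + r *: nu).
  by rewrite opprD addNKr enormN enormZ nu1 mulr1 gtr0_norm.
move=> y Omy; rewrite ltNge; apply/negP => yc.
pose v := y - x.
have yE : y - (x + r *: nu) = v - r *: nu by rewrite opprD addrA.
rewrite yE in yc.
have v2r : `|v| <= 2 * r.
  apply: mxnorm_le_coord => [|i]; first by rewrite mulr_ge0 ?(ltW r0).
  have -> : v ord0 i = (v - r *: nu) ord0 i + (r *: nu) ord0 i.
    by rewrite !mxE subrK.
  apply: le_trans (ler_normD _ _) _; rewrite mulr2n mulrDl !mul1r lerD//.
    exact: le_trans (coord_le_enorm _ _) yc.
  apply: le_trans (coord_le_enorm _ _) _.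
  by rewrite enormZ nu1 mulr1 gtr0_norm.
have vd : `|y - x| < d by exact: le_lt_trans rd.
have vnu : enorm v ^+ 2 <= 2 * r * \sum_i nu ord0 i * v ord0 i.
  have : enorm (v - r *: nu) ^+ 2 <= r ^+ 2.
    by rewrite ler_pXn2r// nnegrE ?enorm_ge0 ?(ltW r0).
  have -> : enorm (v - r *: nu) ^+ 2 = enorm v ^+ 2
      - 2 * r * (\sum_i nu ord0 i * v ord0 i) + r ^+ 2 * enorm nu ^+ 2.
    rewrite !enorm_sqr !mulr_sumr -sumrB -big_split/=.
    by apply: eq_bigr => i _; rewrite !mxE; ring.
  by rewrite nu1; lra.
have := @quadratic_lower_bound rho x y C C0 (fun z zx => H z (le_lt_trans zx vd)).
have gE : \sum_i partial i rho x * (y ord0 i - x ord0 i) =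
    enorm g * \sum_i nu ord0 i * v ord0 i.
  rewrite mulr_sumr; apply: eq_bigr => i _.
  by rewrite !mxE !mulrA mulfV ?gt_eqF// mul1r.
rewrite gE; have := Omrho y vd Omy; rewrite -/v.
set s := \sum_i _ in vnu *; set e2 := enorm v ^+ 2 in vnu *.
have e20 : 0 <= e2 by rewrite sqr_ge0.
have s0 : e2 / (2 * r) <= s by rewrite ler_pdivrMr ?mulr_gt0// mulrC.
have : m * (e2 / (2 * r)) <= enorm g * s.
  by rewrite ler_pM ?(ltW m0)// divr_ge0// mulr_ge0 ?(ltW r0).
have : n%:R ^+ 2 * C * e2 <= m / (2 * r) * e2 by rewrite ler_wpM2r.
have -> : m / (2 * r) * e2 = m * (e2 / (2 * r)) by rewrite mulrAC mulrA.
lra.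
Qed.

(** Point and radius vary jointly, which is the form that the covering characterization of
    compactness consumes. *)
Lemma near_exterior_ball Om x0 : open Om -> frontier Om x0 ->
  (exists (U : set 'rV[R]_n) rho,
      [/\ open U, U x0, smooth_on U rho, grad rho x0 != 0
        & Om `&` U = [set x | U x /\ rho x < 0]]) ->
  \forall x \near x0 & r \near (0 : R)^'+, frontier Om x -> exterior_ball Om r x.
Proof.
move=> oOm frx0 [U [rho [oU Ux0 smU g0 OmU]]].
have [i0 i0P] : exists i, partial i rho x0 != 0.
  apply: contrapT => /forallNP all0; move/eqP: g0; apply; apply/rowP => i.
  by rewrite !mxE; apply/eqP/negPn/negP/all0.
(* Half of a nonzero partial derivative at [x0]: by continuity it remains a lower bound for the
   gradient nearby. In the same way the [+ 1] in [C] leaves room for the second derivatives to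
   vary. *)
pose m := `|partial i0 rho x0| / 2.
have m0 : 0 < m by rewrite divr_gt0// normr_gt0.
pose C := \sum_i \sum_j (`|partial j (partial i rho) x0| + 1).
have C0 : 0 <= C.
  by apply: sumr_ge0 => i _; apply: sumr_ge0 => j _; rewrite addr_ge0.
have CE i j : `|partial j (partial i rho) x0| + 1 <= C.
  apply: le_trans (term_le_sum (F := fun i => \sum_j _) _ i) => [|k].
    by apply: (term_le_sum (F := fun j => `|partial j (partial i rho) x0| + 1)).
  by apply: sumr_ge0 => l _; rewrite addr_ge0.
have : \forall x \near x0, [/\ U x, m <= enorm (grad rho x)
    & forall i j, `|partial j (partial i rho) x| <= C].
  near=> x; split.
  - by near: x; exact: open_nbhs_nbhs.
  - apply: le_trans (coord_le_enorm _ i0); rewrite mxE; near: x.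
    have /differentiable_continuous c1 := smU [:: i0] x0 Ux0.
    have /cvg_norm/cvgr_ge := c1; apply.
    by rewrite /m ltr_pdivrMr// ltr_pMr ?normr_gt0// ltr1n.
  - near: x; apply: filter_forall => i; apply: filter_forall => j.
    have /differentiable_continuous c2 := smU [:: j; i] x0 Ux0.
    have /cvg_norm/cvgr_le := c2; apply.
    by apply: lt_le_trans (CE i j); rewrite ltrDl.
move=> /nbhs_ballP[d/= d0 x0d].
(* The first bound gives [2 * r < d / 2], the second [n ^ 2 * C <= m / (2 * r)], as
   [exterior_ball_criterion] asks. *)
pose r0 := Num.min (d / 4) (m / (2 * (n%:R ^+ 2 * C + 1))).
have K0 : 0 < n%:R ^+ 2 * C + 1 by rewrite ltr_wpDl// mulr_ge0// sqr_ge0.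
have r00 : 0 < r0.
  rewrite lt_min; apply/andP; split; first exact: divr_gt0.
  by apply: divr_gt0 => //; exact: mulr_gt0.
exists (ball x0 (d / 2), [set r | 0 < r < r0]) => /=.
  split; first by apply: nbhsx_ballx; rewrite divr_gt0.
  near=> r; apply/andP; split; near: r; first exact: nbhs_right_gt.
  exact: nbhs_right_lt.
move=> [x r]/= [x0x /andP[r_gt0]]; rewrite lt_min => /andP[rd rm] frx.
have sub y : `|y - x| < d / 2 -> ball x0 d y.
  move=> yx; rewrite [d]splitr; apply: ball_triangle x0x _.
  by rewrite -ball_normE/= distrC.
have [Ux gm _] : [/\ U x, m <= enorm (grad rho x)
    & forall i j, `|partial j (partial i rho) x| <= C].
  by apply/x0d/sub; rewrite subrr normr0 divr_gt0.
apply: (@exterior_ball_criterion Om rho x m C r (d / 2)) => //.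
- rewrite ler_pdivlMr ?mulr_gt0//; move: rm.
  rewrite ltr_pdivlMr ?mulr_gt0// => rm; apply: ltW; apply: le_lt_trans rm.
  nra.
- by move: rd; rewrite ltr_pdivlMr//; lra.
- rewrite leNgt; apply/negP => rhox; apply: (frontier_notin oOm frx).
  by have : [set x | U x /\ rho x < 0] x by []; rewrite -OmU => -[].
- move=> y /sub/x0d[Uy _ _] Omy.
  by have : (Om `&` U) y by []; rewrite OmU => -[].
- move=> y /sub/x0d[Uy _ yC] i; split.
    exact/diff_derivable/(smU [::] y Uy).
  by move=> j; split=> //; exact/diff_derivable/(smU [:: i] y Uy).
Unshelve. all: by end_near. Qed.

(** Compactness of the frontier makes the local radii uniform. *)
Lemma uniform_exterior_ball Om : smooth_bounded_domain Om ->
  exists2 r : R, 0 < r & forall x, frontier Om x -> exterior_ball Om r x.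
Proof.
move=> [_ oOm _ bOm smOm].
have cfr : compact (frontier Om).
  apply: bounded_closed_compact.
    by apply: bounded_subset (bounded_closure bOm) => x [].
  rewrite /frontier setDE; apply: closedI; first exact: closed_closure.
  by apply: open_closedC; exact: open_interior.
have ext := (compact_near_coveringP _).1 cfr R (0^'+)
  (fun r x => frontier Om x -> exterior_ball Om r x) _
  (fun x frx => near_exterior_ball oOm frx (smOm x frx)).
have [r [r0 rP]] := filter_ex (filterI (nbhs_right_gt (0 : R)) (ext _)).
by exists r => // x frx; exact: rP.
Qed.

End exterior_ball_condition.

(** * Barrier functions *)

Section derivative_invariance.
Context {R : realType} {V : normedModType R}.
Implicit Types (f : V -> R) (x v h : V).

Lemma derivable_translate f h x v :
  derivable (fun y => f (y + h)) x v = derivable f (x + h) v.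
Proof.
rewrite /derivable; set g1 := fun k => k^-1 *: _; set g2 := fun k => k^-1 *: _.
by suff -> : g1 = g2 by []; apply/funext => k; rewrite /g1 /g2 /= addrA.
Qed.

Lemma derive_translate f h x v :
  'D_v (fun y => f (y + h)) x = 'D_v f (x + h).
Proof.
rewrite /derive; set g1 := fun k => k^-1 *: _; set g2 := fun k => k^-1 *: _.
by suff -> : g1 = g2 by []; apply/funext => k; rewrite /g1 /g2 /= addrA.
Qed.

Lemma derivable_addcst f (k : R) x v :
  derivable (fun y => f y + k) x v = derivable f x v.
Proof.
rewrite /derivable; set g1 := fun k => k^-1 *: _; set g2 := fun k => k^-1 *: _.
suff -> : g1 = g2 by []; apply/funext => l; rewrite /g1 /g2 /=.
by congr (_ *: _); ring.
Qed.

Lemma derive_addcst f (k : R) x v : 'D_v (fun y => f y + k) x = 'D_v f x.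
Proof.
rewrite /derive; set g1 := fun k => k^-1 *: _; set g2 := fun k => k^-1 *: _.
suff -> : g1 = g2 by []; apply/funext => l; rewrite /g1 /g2 /=.
by congr (_ *: _); ring.
Qed.

(** Made for the barrier, whose restriction to a coordinate line is a polynomial of degree 4: its
    derivative is read off as the linear coefficient. *)
Lemma is_derive_expansion f x v (d k0 k1 k2 : R) :
  (forall s : R, f (x + s *: v) =
     f x + s * d + s ^+ 2 * (k0 + k1 * s + k2 * s ^+ 2)) ->
  is_derive x v f d.
Proof.
move=> fE.
pose q : {poly R} := (f x)%:P + d *: 'X + k0 *: 'X^2 + k1 *: 'X^3 + k2 *: 'X^4.
have qE : (fun s : R => f (x + s *: v)) = horner q.
  apply/funext => s; rewrite fE /q !(hornerD, hornerZ, hornerXn, hornerC, hornerX); ring.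
have x0 : x + 0 *: v = x by rewrite scale0r addr0.
apply: DeriveDef.
  by rewrite -[X in derivable _ X]x0 -derivable_lineE qE; exact: derivable_horner.
rewrite -[X in 'D_v _ X]x0 -derive_lineE qE -derive1E -derivE /q.
rewrite !derivD !derivZ derivC derivX !derivXn.
by rewrite !(hornerD, hornerZ, hornerMn, hornerXn, hornerC, hornerX) /=; ring.
Qed.

Lemma derive_norm_le f x v (L : R) : derivable f x v ->
  (\forall s \near (0 : R)^', `|f (x + s *: v) - f x| <= L * `|s|) ->
  `|'D_v f x| <= L.
Proof.
move=> df fL.
have : `|h^-1 *: ((f \o shift x) (h *: v) - f x)| @[h --> (0 : R)^'] --> `|'D_v f x|.
  exact: cvg_norm df.
move=> dcvg; rewrite -(cvg_lim _ dcvg)//; apply: limr_le.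
  by apply/cvg_ex; eexists; exact: dcvg.
near=> h; have h0 : h != 0 by near: h; exact: nbhs_dnbhs_neq.
have fh : `|f (x + h *: v) - f x| <= L * `|h| by near: h.
by rewrite normrM normfV mulrC ler_pdivrMr ?normr_gt0//= [_ + x]addrC.
Unshelve. all: by end_near. Qed.

End derivative_invariance.

Section barrier.
Context {R : realType} {n : nat}.
Variables (c : 'rV[R]_n) (r a A : R).
Hypothesis r0 : 0 < r.
Implicit Types x : 'rV[R]_n.

(* Polynomial substitute for |x - c| - r: both vanish on the sphere, and
   sphere_gap x - (|x - c| - r) = (|x - c| - r)^2 / (2 r). *)
Definition sphere_gap x : R := (enorm (x - c) ^+ 2 - r ^+ 2) / (2 * r).

(** As a function of the gap it has slope [a] at the sphere and constant concavity [A]; the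
    concavity is what pays for the gradient nonlinearity. *)
Definition barrier x : R := a * sphere_gap x - A / 2 * sphere_gap x ^+ 2.

Lemma sphere_gap_line x i s :
  sphere_gap (x + s *: basis_vec i) =
  sphere_gap x + s * ((x ord0 i - c ord0 i) / r) + s ^+ 2 * (2 * r)^-1.
Proof.
rewrite /sphere_gap !enorm_sqr (bigD1 i)//= [X in _ = (X - _) / _ + _ + _](bigD1 i)//=.
rewrite (eq_bigr (fun j => (x - c) ord0 j ^+ 2)) => [|j ji]; last first.
  by rewrite !mxE eqxx (negbTE ji) mulr0 addr0.
by rewrite !mxE !eqxx mulr1/=; field; rewrite gt_eqF.
Qed.

Lemma is_derive_barrier x i : is_derive x (basis_vec i) barrier
  ((a - A * sphere_gap x) * ((x ord0 i - c ord0 i) / r)).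
Proof.
pose al := (x ord0 i - c ord0 i) / r; pose be := (2 * r)^-1.
apply: (@is_derive_expansion _ _ _ _ _ _
  (a * be - A / 2 * (al ^+ 2 + 2 * sphere_gap x * be))
  (- A * al * be) (- A / 2 * be ^+ 2)) => s.
by rewrite /barrier sphere_gap_line -/al -/be; field.
Qed.

Lemma partial_barrier i : partial i barrier =
  fun x => (a - A * sphere_gap x) * ((x ord0 i - c ord0 i) / r).
Proof.
by apply/funext => x; apply: derive_val; exact: is_derive_barrier.
Qed.

Lemma is_derive_partial_barrier x i :
  is_derive x (basis_vec i) (partial i barrier)
    ((a - A * sphere_gap x) / r - A * ((x ord0 i - c ord0 i) / r) ^+ 2).
Proof.
pose al := (x ord0 i - c ord0 i) / r; pose be := (2 * r)^-1.
rewrite partial_barrier.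
apply: (@is_derive_expansion _ _ _ _ _ _
  (- A * al / r - A * be * al) (- A * be / r) 0) => s.
rewrite sphere_gap_line -/al -/be.
have -> : ((x + s *: basis_vec i) ord0 i - c ord0 i) / r = al + s / r.
  by rewrite !mxE !eqxx mulr1 addrAC mulrDl.
by field; rewrite gt_eqF.
Qed.

Lemma regular_barrier (t : R) x : regular_at (fun=> barrier) t x.
Proof.
split=> [|i|i]; first exact: derivable_cst.
  by have := is_derive_barrier x i.
by have := is_derive_partial_barrier x i.
Qed.

Lemma laplacian_barrier x : laplacian barrier x =
  n%:R * ((a - A * sphere_gap x) / r) - A * (enorm (x - c) / r) ^+ 2.
Proof.
rewrite /laplacian (eq_bigr (fun i =>
  (a - A * sphere_gap x) / r - A / r ^+ 2 * (x - c) ord0 i ^+ 2)).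
  rewrite sumrB sumr_const card_ord -[_ *+ n]mulr_natl -mulr_sumr -enorm_sqr.
  by rewrite expr_div_n; ring.
move=> i _; have /@derive_val := is_derive_partial_barrier x i.
by rewrite /partial => ->; rewrite !mxE expr_div_n; ring.
Qed.

Lemma grad_barrier x : grad barrier x = ((a - A * sphere_gap x) / r) *: (x - c).
Proof.
by apply/rowP => i; rewrite !mxE partial_barrier; ring.
Qed.

(** For a gap between 0 and [r], the distance to [c] lies between [r] and [2 * r], so the gradient
    of the gap has norm between 1 and 2. The barrier then has slope at most [2 * a], and the
    concavity contributes at most [- A] to its Laplacian. *)
Lemma barrier_supersolution (p : R) x : 0 <= p ->
  0 <= A -> 0 <= sphere_gap x -> sphere_gap x <= r ->
  A * sphere_gap x <= a -> (2 * a) `^ p + n%:R * (a / r) <= A ->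
  laplacian barrier x + enorm (grad barrier x) `^ p <= 0.
Proof.
move=> p0 A0 q0 qr qa HA.
have e2 : enorm (x - c) ^+ 2 = r ^+ 2 + 2 * r * sphere_gap x.
  by rewrite /sphere_gap; field; rewrite gt_eqF.
have a0 : 0 <= a by apply: le_trans qa; rewrite mulr_ge0.
have er : r <= enorm (x - c).
  rewrite -(@ler_pXn2r _ 2) ?nnegrE ?enorm_ge0 ?(ltW r0)// e2 lerDl.
  by apply: mulr_ge0 => //; apply: mulr_ge0 => //; exact: ltW.
have e2r : enorm (x - c) <= 2 * r.
  rewrite -(@ler_pXn2r _ 2) ?nnegrE ?enorm_ge0 ?mulr_ge0 ?(ltW r0)// e2.
  have : r * sphere_gap x <= r * r by rewrite ler_wpM2l// ltW.
  have : 0 <= r * r by rewrite mulr_ge0// ltW.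
  by rewrite !expr2; lra.
have Aq0 : 0 <= A * sphere_gap x by rewrite mulr_ge0.
have gradp : enorm (grad barrier x) `^ p <= (2 * a) `^ p.
  apply: ge0_ler_powR => //; rewrite ?nnegrE ?enorm_ge0 ?mulr_ge0//.
  rewrite grad_barrier enormZ ger0_norm ?divr_ge0 ?subr_ge0 ?(ltW r0)//.
  rewrite mulrAC ler_pdivrMr//.
  have -> : 2 * a * r = a * (2 * r) by ring.
  by apply: ler_pM; rewrite ?enorm_ge0 ?subr_ge0// gerBl.
have lap : laplacian barrier x <= n%:R * (a / r) - A.
  rewrite laplacian_barrier; apply: lerB.
    apply: ler_wpM2l => //; apply: ler_wpM2r; first by rewrite invr_ge0 ltW.
    by rewrite gerBl.
  by rewrite ler_peMr// exprn_ege1// ler_pdivlMr// mul1r.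
lra.
Qed.

End barrier.

(** * Estimates for solutions *)

Section shift_invariance.
Context {R : realType} {n : nat}.
Implicit Types (t : R) (x : 'rV[R]_n).

Lemma partial_shift (f : 'rV[R]_n -> R) (v : 'rV[R]_n) (k : R) i :
  partial i (fun y => f (y + v) + k) = fun y => partial i f (y + v).
Proof.
by apply/funext => y; rewrite /partial derive_addcst derive_translate.
Qed.

Lemma regular_at_shift (f : R -> 'rV[R]_n -> R) (h : R) (v : 'rV[R]_n) (k : R)
    t x :
  regular_at f (t + h) (x + v) ->
  regular_at (fun s y => f (s + h) (y + v) + k) t x.
Proof.
move=> [dt dx dxx]; split=> [|i|i].
- change (derivable (fun s => f (s + h) (x + v) + k) t 1).
  rewrite (derivable_addcst (fun s => f (s + h) (x + v)) k).
  by rewrite (derivable_translate (fun s => f s (x + v)) h); exact: dt.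
- change (derivable (fun y => f (t + h) (y + v) + k) x (basis_vec i)).
  rewrite (derivable_addcst (fun y => f (t + h) (y + v)) k).
  by rewrite (derivable_translate (f (t + h)) v); exact: dx.
- change (derivable (partial i (fun y => f (t + h) (y + v) + k)) x (basis_vec i)).
  by rewrite partial_shift (derivable_translate (partial i (f (t + h))) v); exact: dxx.
Qed.

(** The equation is autonomous in time and space and contains [u] only through its derivatives, so
    translating a solution and adding a constant gives another. *)
Lemma heat_residual_shift (G : 'rV[R]_n -> R) (f : R -> 'rV[R]_n -> R) (h : R)
    (v : 'rV[R]_n) (k : R) t x :
  heat_residual G (fun s y => f (s + h) (y + v) + k) t x =
  heat_residual G f (t + h) (x + v).
Proof.
have -> : heat_residual G (fun s y => f (s + h) (y + v) + k) t x =
    derive1 (fun s => f (s + h) (x + v) + k) t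
    - laplacian (fun y => f (t + h) (y + v) + k) x
    - G (grad (fun y => f (t + h) (y + v) + k) x) by [].
have lapE : laplacian (fun y => f (t + h) (y + v) + k) x =
    laplacian (f (t + h)) (x + v).
  apply: eq_bigr => i _; rewrite partial_shift.
  exact: (derive_translate (partial i (f (t + h))) v).
have gradE : grad (fun y => f (t + h) (y + v) + k) x = grad (f (t + h)) (x + v).
  by apply/rowP => i; rewrite !mxE partial_shift.
rewrite lapE gradE /heat_residual !derive1E.
rewrite (derive_addcst (fun s => f (s + h) (x + v)) k).
by rewrite (derive_translate (fun s => f s (x + v)) h).
Qed.

End shift_invariance.

Section solution_estimates.
Context {R : realType} {n : nat}.
Variables (p T : R) (Om : set 'rV[R]_n) (u : R -> 'rV[R]_n -> R).
Implicit Types (t s : R) (x y : 'rV[R]_n).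

Let F (v : 'rV[R]_n) := enorm v `^ p.

Hypotheses (p2 : 2 < p) (oOm : open Om) (bOm : bounded_set Om).
Hypothesis ucont : {within [set t | 0 < t < T] `*` closure Om,
  continuous (fun z : R * 'rV[R]_n => u z.1 z.2)}.
Hypothesis ureg : forall t x, 0 < t < T -> Om x -> regular_at u t x.
Hypothesis ueq : forall t x, 0 < t < T -> Om x -> heat_residual F u t x = 0.
Hypothesis ubd : forall t x, 0 < t < T -> frontier Om x -> u t x = 0.

Let p0 : 0 <= p.
Proof. by apply: ltW; apply: lt_trans p2. Qed.

Lemma closure_frontier x : closure Om x -> ~ Om x -> frontier Om x.
Proof. by move=> clx nx; split; rewrite ?(interior_id _).1. Qed.

Lemma solution_continuous_within (t0 t1 : R) (D : set 'rV[R]_n) (h : R)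
    (v : 'rV[R]_n) : 0 < t0 + h -> t1 + h < T ->
  (forall x, D x -> closure Om (x + v)) ->
  {within `[t0, t1] `*` D,
    continuous (fun z : R * 'rV[R]_n => u (z.1 + h) (z.2 + v))}.
Proof.
move=> t0h t1h DOm.
apply: (@continuous_within_comp _ _ _ _ _ (fun z : R * 'rV[R]_n => u z.1 z.2)
  (fun z : R * 'rV[R]_n => (z.1 + h, z.2 + v)) _ _ ucont).
  move=> z.
  have c1 : (fun z : R * 'rV[R]_n => z.1 + h) @ z --> z.1 + h.
    by apply: cvgD; [exact: cvg_fst|exact: cvg_cst].
  have c2 : (fun z : R * 'rV[R]_n => z.2 + v) @ z --> z.2 + v.
    by apply: cvgD; [exact: cvg_snd|exact: cvg_cst].
  exact: (cvg_pair c1 c2).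
move=> [t x] [/=]; rewrite in_itv/= => /andP[t0t tt1] Dx; split=> /=.
  by apply/andP; split; lra.
exact: DOm.
Qed.

Lemma sphere_gap_continuous (c : 'rV[R]_n) (r : R) :
  0 < r -> continuous (sphere_gap c r).
Proof.
move=> r0 x.
have -> : sphere_gap c r =
    (fun y => (\sum_i (y - c) ord0 i ^+ 2 - r ^+ 2) * (2 * r)^-1).
  by apply/funext => y; rewrite /sphere_gap enorm_sqr.
apply: (@cvgMl _ _ (nbhs x)); apply: (@cvgB _ _ _ (nbhs x)); last exact: cvg_cst.
apply: cvg_big => [|i _]; first exact: add_continuous.
have ci : (fun y : 'rV[R]_n => (y - c) ord0 i) @ x --> (x - c) ord0 i.
  have cB : (fun y : 'rV[R]_n => y - c) @ x --> x - c.
    by apply: (@cvgB _ _ _ (nbhs x) _ id (cst c)); [exact: cvg_id|exact: cvg_cst].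
  exact: (cvg_comp _ _ cB (@coord_continuous R 1 n ord0 i (x - c))).
exact: (cvgM ci ci).
Qed.

(* On {sphere_gap < eta} the barrier has slope between 3 B and 4 B, so at
   sphere_gap = eta it leaves room for u to grow in time by B eta. *)
Lemma barrier_bound (c : 'rV[R]_n) (r B eta A t0 t1 : R) :
  0 < r -> (forall y, Om y -> r < enorm (y - c)) ->
  0 < B -> 0 < eta -> eta <= r -> A * eta <= B ->
  (2 * (4 * B)) `^ p + n%:R * (4 * B / r) <= A ->
  0 < t0 -> t0 <= t1 -> t1 < T ->
  (forall x w, Om x -> ~ Om w -> `|u t0 x| <= B * enorm (w - x)) ->
  (forall t x, t0 <= t <= t1 -> Om x -> `|u t x - u t0 x| <= B * eta) ->
  forall t x, t0 <= t <= t1 -> Om x -> sphere_gap c r x < eta ->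
    `|u t x| <= 4 * B * sphere_gap c r x.
Proof.
move=> r0 ext B0 eta0 etar Aeta HA t00 t01 t1T exit tlip.
have A0 : 0 <= A.
  apply: le_trans HA; rewrite addr_ge0 ?powR_ge0// mulr_ge0//.
  by apply: divr_ge0; [apply: mulr_ge0 => //; exact: ltW|exact: ltW].
pose q := sphere_gap c r; pose w := barrier c r (4 * B) A.
have cq : continuous q by exact: sphere_gap_continuous.
have q0 y : closure Om y -> 0 <= q y.
  have cl0 : closed [set y | 0 <= q y].
    apply: (@closed_comp _ _ q [set s | 0 <= s]); last exact: closed_ge.
    by move=> z _; exact: cq.
  have sub : Om `<=` [set y | 0 <= q y].
    move=> z /ext rz; apply: divr_ge0; last by rewrite mulr_ge0// ltW.
    by rewrite subr_ge0 ler_pXn2r ?nnegrE ?enorm_ge0 ?(ltW r0) ?(ltW rz).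
  by move=> /(closureS sub); rewrite -(closure_id _).1.
pose D := Om `&` [set x | q x < eta].
have oD : open D.
  apply: openI => //; apply: (@open_comp _ _ q [set s | s < eta]).
    by move=> z _; exact: cq.
  exact: open_lt.
have bD : bounded_set D by apply: bounded_subset bOm => x [].
have clD y : closure D y -> closure Om y /\ q y <= eta.
  have cl1 : closed [set y | q y <= eta].
    apply: (@closed_comp _ _ q [set s | s <= eta]); last exact: closed_le.
    by move=> z _; exact: cq.
  have DOm : D `<=` Om by move=> z [].
  move=> cly; split; first exact: closureS DOm _ cly.
  have sub : D `<=` [set y | q y <= eta] by move=> z [_ /ltW].
  by have := closureS sub cly; rewrite -(closure_id _).1.
(* Since [A * q y <= A * eta <= B], the quadratic term is at most [B * q y / 2]. *)
have wq y : 0 <= q y -> q y <= eta -> 3 * B * q y <= w y <= 4 * B * q y.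
  move=> qy0 qye; rewrite /w /barrier -/q.
  have Aq : A * q y * q y <= B * q y.
    by apply: ler_wpM2r => //; apply: le_trans Aeta; rewrite ler_wpM2l.
  have Aq0 : 0 <= A * q y * q y by do 2! [apply: mulr_ge0 => //].
  have Bq0 : 0 <= B * q y by apply: mulr_ge0 => //; exact: ltW.
  have -> : A / 2 * q y ^+ 2 = A * q y * q y / 2 by rewrite expr2; field.
  by apply/andP; split; lra.
(* The radial projection [z] of [y] onto the sphere lies outside [Om], at distance
   [enorm (y - c) - r], which the gap dominates. *)
have exit_gap y : Om y -> `|u t0 y| <= B * q y.
  move=> Omy; have ry := ext y Omy.
  have ey0 : 0 < enorm (y - c) by exact: lt_trans ry.
  pose z := c + (r / enorm (y - c)) *: (y - c).
  have zc : z - c = (r / enorm (y - c)) *: (y - c) by rewrite addrC addKr.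
  have nz : ~ Om z.
    move=> /ext; rewrite zc enormZ gtr0_norm ?divr_gt0// divfK ?gt_eqF//.
    by rewrite ltxx.
  apply: le_trans (exit y z Omy nz) _; apply: ler_wpM2l; first exact: ltW.
  have -> : z - y = - ((1 - r / enorm (y - c)) *: (y - c)).
    by apply/rowP => i; rewrite !mxE; ring.
  have k0 : 0 <= 1 - r / enorm (y - c).
    by rewrite subr_ge0 ler_pdivrMr// mul1r ltW.
  rewrite enormN enormZ ger0_norm// mulrBl mul1r divfK ?gt_eqF//.
  rewrite /q /sphere_gap ler_pdivlMr ?mulr_gt0//.
  by have := sqr_ge0 (enorm (y - c) - r); rewrite !expr2; lra.
have init y : closure D y -> `|u t0 y| <= w y.
  move=> /clD[cly qy]; have /andP[wl _] := wq y (q0 y cly) qy.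
  have Bq0 : 0 <= B * q y by apply: mulr_ge0; [exact: ltW|exact: q0].
  have [Omy|nOmy] := pselect (Om y).
    by apply: le_trans (exit_gap y Omy) _; lra.
  rewrite ubd ?normr0; last exact: closure_frontier.
    by lra.
  by rewrite t00 (le_lt_trans _ t1T)//; exact: t01.
(* Either [y] is on the frontier of [Om], where [u] vanishes, or the gap equals [eta]; there [u] is
   at most [2 * B * eta], below the [3 * B * eta] guaranteed by [wq]. *)
have lateral t y : t0 <= t <= t1 -> closure D y -> ~ D y -> `|u t y| <= w y.
  move=> tt /clD[cly qy] nDy; have /andP[wl _] := wq y (q0 y cly) qy.
  have Bq0 : 0 <= B * q y by apply: mulr_ge0; [exact: ltW|exact: q0].
  have [Omy|nOmy] := pselect (Om y); last first.
    rewrite ubd ?normr0; last exact: closure_frontier.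
      by lra.
    by case/andP: tt => ? ?; apply/andP; split; lra.
  have qE : q y = eta.
    by apply/eqP; rewrite eq_le qy leNgt; apply/negP => qlt; apply: nDy.
  have := ler_normD (u t y - u t0 y) (u t0 y); rewrite subrK => uE.
  apply: le_trans uE _.
  have := tlip t y tt Omy; have := exit_gap y Omy.
  move: wl Bq0; rewrite qE.
  lra.
have gapt t : t0 < t <= t1 -> 0 < t < T.
  by move=> /andP[? ?]; apply/andP; split; lra.
have regu t y : t0 < t <= t1 -> D y -> regular_at u t y.
  by move=> /gapt tT [Omy _]; exact: ureg.
have lapw y : D y -> laplacian w y + F (grad w y) <= 0.
  move=> Dy; have [cly qy] := clD _ (subset_closure Dy).
  apply: barrier_supersolution => //; first exact: q0.
    exact: le_trans qy etar.
  apply: (@le_trans _ _ B); first by apply: le_trans Aeta; rewrite ler_wpM2l.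
  by lra.
have ucD : {within `[t0, t1] `*` closure D,
    continuous (fun z : R * 'rV[R]_n => u z.1 z.2)}.
  apply: continuous_subspaceW ucont => -[t y] [/=].
  rewrite in_itv/= => /andP[? ?] /clD[? _]; split=> //=.
  by apply/andP; split; lra.
have wcD : {within `[t0, t1] `*` closure D,
    continuous (fun z : R * 'rV[R]_n => w z.2)}.
  apply: continuous_subspaceT => z.
  have c2 : (fun z : R * 'rV[R]_n => w z.2) = (fun z => w z) \o snd by [].
  apply: (@continuous_comp _ _ _ snd w); first exact: cvg_snd.
  have cw : w = (fun y => 4 * B * q y - A / 2 * (q y * q y)).
    by apply/funext => y; rewrite /w /barrier expr2.
  rewrite /continuous_at cw; apply: (@cvgB _ _ _ (nbhs z.2)).
    by apply: cvgMr; exact: cq.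
  by apply: cvgMr; apply: cvgM; exact: cq.
have F0 v : 0 <= F v by exact: powR_ge0.
have resw t y : heat_residual F (fun=> w) t y = - laplacian w y - F (grad w y).
  by rewrite /heat_residual derive1_cst sub0r.
have gradN y : grad (fun z => - w z) y = - grad w y.
  apply/rowP => i; rewrite !mxE.
  have [_ /(_ i) dw _] := regular_barrier c (4 * B) A r0 0 y.
  exact: deriveN.
have partialN i : partial i (fun z => - w z) = (fun z => - partial i w z).
  apply/funext => z.
  by have := congr1 (fun v : 'rV[R]_n => v ord0 i) (gradN z); rewrite !mxE.
have lapN y : laplacian (fun z => - w z) y = - laplacian w y.
  rewrite /laplacian -sumrN; apply: eq_bigr => i _; rewrite partialN.
  by have [_ _ /(_ i) dw] := regular_barrier c (4 * B) A r0 0 y; exact: deriveN.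
have regN t y : regular_at (fun=> (fun z => - w z)) t y.
  have [_ dw ddw] := regular_barrier c (4 * B) A r0 0 y.
  split=> [|i|i]; first exact: derivable_cst.
    exact: derivableN.
  by rewrite partialN; exact: derivableN.
have resN t y : heat_residual F (fun=> (fun z => - w z)) t y
    = laplacian w y - F (grad w y).
  by rewrite /heat_residual derive1_cst sub0r lapN opprK gradN /F enormN.
have upper : forall t y, t0 <= t <= t1 -> closure D y -> u t y <= w y.
  apply: (@comparison _ _ F D t0 t1 u (fun=> w) oD bD).
  - exact: continuous_withinB.
  - exact: regu.
  - by move=> *; exact: regular_barrier.
  - move=> s z st Dz; rewrite resw ueq; [|exact: gapt|by case: Dz].
    by have := lapw z Dz; lra.
  - by move=> z /init; apply: le_trans; exact: ler_norm.
  - by move=> s z st cz nz; apply: le_trans (lateral s z st cz nz); exact: ler_norm.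
(* [- w] is a subsolution: its residual is [laplacian w - F (grad w)], and [F] is nonnegative. *)
have lower : forall t y, t0 <= t <= t1 -> closure D y -> - w y <= u t y.
  apply: (@comparison _ _ F D t0 t1 (fun=> (fun z => - w z)) u oD bD).
  - apply: continuous_withinB => // z; apply: (@cvgN _ _ _ (nbhs (z : subspace _))).
    exact: wcD.
  - by move=> *; exact: regN.
  - exact: regu.
  - move=> s z st Dz; rewrite resN ueq; [|exact: gapt|by case: Dz].
    by have := lapw z Dz; have := F0 (grad w z); lra.
  - by move=> z /init; rewrite ler_norml => /andP[].
  - by move=> s z st cz nz; have := lateral s z st cz nz; rewrite ler_norml => /andP[].
move=> t y tt Omy qy.
have Dy : closure D y by exact: subset_closure.
have [cly qle] := clD y Dy; have /andP[_ wr] := wq y (q0 y cly) qle.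
by apply: le_trans wr; rewrite ler_norml lower//= upper.
Qed.

(** Close to [x0], the barrier of the ball touching at [x0] applies, and the gap is at most
    [(n + 1) * d]. Farther away [eta <= (n + 1) * d], so the allowed growth [B * eta] is itself
    linear in the distance. *)
Lemma boundary_lipschitz (r B eta A t0 t1 : R) :
  0 < r -> (forall x, frontier Om x -> exterior_ball Om r x) ->
  0 < B -> 0 < eta -> eta <= r -> A * eta <= B ->
  (2 * (4 * B)) `^ p + n%:R * (4 * B / r) <= A ->
  0 < t0 -> t0 <= t1 -> t1 < T ->
  (forall x w, Om x -> ~ Om w -> `|u t0 x| <= B * enorm (w - x)) ->
  (forall t x, t0 <= t <= t1 -> Om x -> `|u t x - u t0 x| <= B * eta) ->
  forall t x x0, t0 <= t <= t1 -> closure Om x -> frontier Om x0 ->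
    `|u t x| <= 4 * B * (n%:R + 1) * enorm (x - x0).
Proof.
move=> r0 ext B0 eta0 etar Aeta HA t00 t01 t1T exit tlip t x x0 tt clx frx0.
have n0 : 0 <= (n%:R : R) by exact: ler0n.
have d0 : 0 <= enorm (x - x0) by exact: enorm_ge0.
have L0 : 0 <= 4 * B * (n%:R + 1).
  by apply: mulr_ge0; [apply: mulr_ge0 => //; exact: ltW|exact: addr_ge0].
have [Omx|nOmx] := pselect (Om x); last first.
  rewrite ubd ?normr0; last exact: (closure_frontier clx nOmx).
    exact: mulr_ge0.
  by case/andP: tt => ? ?; apply/andP; split; lra.
set d := enorm (x - x0) in d0 *.
have [dsmall|dlarge] := ltP ((n%:R + 1) * d) eta.
  have [c cx0 extc] := ext x0 frx0.
  have dr : d <= r.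
    apply: le_trans etar; apply: le_trans (ltW dsmall).
    by rewrite ler_peMl// lerDr.
  have gap : sphere_gap c r x <= (n%:R + 1) * d.
    rewrite /sphere_gap ler_pdivrMr ?mulr_gt0//.
    have -> : enorm (x - c) ^+ 2 = d ^+ 2 + r ^+ 2
        + 2 * \sum_i (x0 - c) ord0 i * (x - x0) ord0 i.
      rewrite -cx0 /d !enorm_sqr mulr_sumr -!big_split/=.
      by apply: eq_bigr => i _; rewrite !mxE; ring.
    have := @sum_coordM_le _ _ (fun i => (x0 - c) ord0 i) r (x - x0).
    move=> /(_ _)/wrap[i|]; first by rewrite -cx0 coord_le_enorm.
    rewrite -/d ler_norml => /andP[_].
    set S := \sum_i _ => Sle.
    have : d * d <= r * d by exact: ler_wpM2r.
    have : 0 <= r * d by apply: mulr_ge0 => //; exact: ltW.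
    by move: Sle; rewrite !expr2; move: (n%:R) => m; nra.
  have := barrier_bound r0 extc B0 eta0 etar Aeta HA t00 t01
    t1T exit tlip tt Omx (le_lt_trans gap dsmall).
  move=> /le_trans; apply; rewrite -[leRHS]mulrA; apply: ler_wpM2l => //.
  by apply: mulr_ge0 => //; exact: ltW.
have := ler_normD (u t x - u t0 x) (u t0 x); rewrite subrK => uE.
apply: le_trans uE _.
have := exit x x0 Omx (frontier_notin oOm frx0).
rewrite -enormN opprB -/d; have := tlip t x tt Omx.
have : B * eta <= B * ((n%:R + 1) * d) by apply: ler_wpM2l => //; exact: ltW.
have : 0 <= B * d by apply: mulr_ge0 => //; exact: ltW.
have : 0 <= B * (n%:R * d).
  by apply: mulr_ge0; [exact: ltW|exact: mulr_ge0].
have -> : 4 * B * (n%:R + 1) * d = 4 * (B * (n%:R * d)) + 4 * (B * d) by ring.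
have -> : B * ((n%:R + 1) * d) = B * (n%:R * d) + B * d by ring.
lra.
Qed.

(** Comparison runs on the overlap of [Om] with its translate by [- v]. On the boundary of the
    overlap [x] or [x + v] is outside [Om], which is the lateral case. *)
Lemma shift_comparison (h k t0 t1 : R) (v : 'rV[R]_n) :
  0 < t0 -> 0 < t0 + h -> t1 < T -> t1 + h < T ->
  (forall x, closure Om x -> closure Om (x + v) ->
     u (t0 + h) (x + v) <= u t0 x + k) ->
  (forall t x, t0 <= t <= t1 -> closure Om x -> closure Om (x + v) ->
     ~ (Om x /\ Om (x + v)) -> u (t + h) (x + v) <= u t x + k) ->
  forall t x, t0 <= t <= t1 -> Om x -> Om (x + v) ->
    u (t + h) (x + v) <= u t x + k.
Proof.
move=> t00 t0h t1T t1h init lateral t x tt Omx Omxv.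
pose D := Om `&` [set y | Om (y + v)].
have ctr : continuous (fun y : 'rV[R]_n => y + v).
  by move=> y; apply: (@cvgD _ _ _ (nbhs y) _ id (cst v));
    [exact: cvg_id|exact: cvg_cst].
have oD : open D.
  by apply: openI => //; apply: open_comp => // y _; exact: ctr.
have bD : bounded_set D by apply: bounded_subset bOm => y [].
have clD y : closure D y -> closure Om y /\ closure Om (y + v).
  have DOm : D `<=` Om by move=> z [].
  move=> cly; split; first exact: closureS DOm _ cly.
  move=> W /ctr Wy; have [z [[_ Omzv] Wz]] := cly _ Wy.
  by exists (z + v).
have timeP s : t0 < s <= t1 -> 0 < s < T /\ 0 < s + h < T.
  by move=> /andP[? ?]; split; apply/andP; split; lra.
have Dx : closure D x by exact: subset_closure.
have cu g w l (gs : 0 < t0 + g) (ge : t1 + g < T)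
    (cw : forall y, closure D y -> closure Om (y + w)) :
    {within `[t0, t1] `*` closure D,
      continuous (fun z : R * 'rV[R]_n => u (z.1 + g) (z.2 + w) + l)}.
  move=> z; apply: (@cvgD _ _ _ (nbhs z)); last exact: cvg_cst.
  exact: (solution_continuous_within gs ge cw).
have cmp : forall t x, t0 <= t <= t1 -> closure D x ->
    u (t + h) (x + v) + 0 <= u (t + 0) (x + 0) + k.
  (* The zero shift and zero constant give both functions the form of the translation lemmas. *)
  apply: (@comparison _ _ F D t0 t1 (fun s y => u (s + h) (y + v) + 0)
    (fun s y => u (s + 0) (y + 0) + k) oD bD).
  - have s0 : 0 < t0 + 0 by rewrite addr0.
    have e0 : t1 + 0 < T by rewrite addr0.
    have cl0 y : closure D y -> closure Om (y + 0) by rewrite addr0 => /clD[].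
    have c1 := cu h v 0 t0h t1h (fun y Dy => (clD y Dy).2).
    exact: (continuous_withinB c1 (cu 0 0 k s0 e0 cl0)).
  - move=> s y /timeP[_ sT] [_ Dy]; apply: regular_at_shift; exact: ureg.
  - move=> s y /timeP[sT _] [Dy _]; apply: regular_at_shift.
    by rewrite !addr0; exact: ureg.
  - move=> s y /timeP[sT shT] [Dy Dyv].
    by rewrite !heat_residual_shift !addr0 !ueq.
  - by move=> y /clD[? ?]; rewrite !addr0; exact: init.
  - by move=> s y st /clD[? ?] nD; rewrite !addr0; exact: lateral.
by have := cmp t x tt Dx; rewrite !addr0.
Qed.

(** On the boundary of the overlap one of [x], [x + v] is a frontier point, where [u] vanishes, and
    the other is at distance [enorm v] from it. *)
Lemma spatial_lipschitz (t0 t1 L : R) : 0 < t0 -> t1 < T -> 0 <= L ->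
  (forall t x x0, t0 <= t <= t1 -> closure Om x -> frontier Om x0 ->
     `|u t x| <= L * enorm (x - x0)) ->
  (forall x y, closure Om x -> closure Om y ->
     `|u t0 y - u t0 x| <= L * enorm (y - x)) ->
  forall t x v, t0 <= t <= t1 -> Om x -> Om (x + v) ->
    u t (x + v) - u t x <= L * enorm v.
Proof.
move=> t00 t1T L0 bdry init t x v tt Omx Omxv.
have vE y : y + v - y = v by rewrite addrC addKr.
rewrite lerBlDl -[X in u X (x + v)]addr0.
apply: (@shift_comparison 0 _ t0 t1 v) => //; rewrite ?addr0//.
  move=> y cly clyv; rewrite -lerBlDl; apply: le_trans (ler_norm _) _.
  by rewrite -[in leRHS](vE y); exact: init.
move=> s y st cly clyv /not_andP nOm; rewrite addr0 -lerBlDl.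
have sT : 0 < s < T by case/andP: st => ? ?; apply/andP; split; lra.
case: nOm => [nOm|nOm].
  have fry := closure_frontier cly nOm.
  rewrite (ubd sT fry) subr0; apply: le_trans (ler_norm _) _.
  by rewrite -[in leRHS](vE y); exact: bdry.
have fryv := closure_frontier clyv nOm.
rewrite (ubd sT fryv) sub0r; apply: le_trans (ler_norm _) _; rewrite normrN.
have -> : enorm v = enorm (y - (y + v)) by rewrite opprD addNKr enormN.
exact: bdry.
Qed.

(** The one-sided hypothesis, used from [x] to [x + s *: basis_vec i] and back, gives both signs. *)
Lemma partial_le_lipschitz (t L : R) :
  0 < t < T ->
  (forall x v, Om x -> Om (x + v) -> u t (x + v) - u t x <= L * enorm v) ->
  forall x i, Om x -> `|partial i (u t) x| <= L.
Proof.
move=> tT lip x i Omx; have [d d0 xd] := open_line_nbhs oOm Omx.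
have [_ dx _] := ureg tT Omx.
apply: derive_norm_le; first exact: dx.
near=> s.
have sd : `|s| < d.
  near: s; apply: (@cvg_within _ (nbhs (0 : R))).
  by exists d => // s; rewrite /= sub0r normrN.
have Omxs := xd i s sd.
have E : enorm (s *: basis_vec i : 'rV[R]_n) = `|s|.
  by rewrite enormZ enorm_basis_vec mulr1.
have Omx' : Om (x + s *: basis_vec i + - (s *: basis_vec i)) by rewrite addrK.
have := lip _ _ Omx Omxs; have := lip _ _ Omxs Omx'.
rewrite addrK enormN E => h1 h2; rewrite ler_norml h2 andbT.
by rewrite lerNl opprB.
Unshelve. all: by end_near. Qed.

(** The bound on the time derivative near [T / 2] gives the estimate at time [T / 2]; comparing [u]
    with its time translate carries it to all later times, since both vanish on the frontier. *)
Lemma time_lipschitz (K : R) :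
  (forall t x, T / 4 <= t <= 3 * T / 4 -> Om x ->
     `|derive1 (fun s => u s x) t| <= K) ->
  forall s h x, 0 <= h <= T / 4 -> T / 2 <= s -> s + h < T -> Om x ->
    `|u (s + h) x - u s x| <= K * h.
Proof.
move=> utK s h x /andP[h0 hT] Ts shT Omx.
have T0 : 0 < T by lra.
have init y : closure Om y -> `|u (T / 2 + h) y - u (T / 2) y| <= K * h.
  move=> cly; have [Omy|nOmy] := pselect (Om y).
    (* [mvt_affine] asks for derivatives on an interval symmetric about 0, hence the lower end
       [T / 4] in [utK]. *)
    have := @mvt_affine _ (fun r => u (r + T / 2) y) 0 K h.
    rewrite add0r mul0r subr0 (ger0_norm h0) (addrC h) => mvt.
    apply: mvt => r; rewrite ler_norml => /andP[r1 r2].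
    have rT : 0 < r + T / 2 < T by apply/andP; split; lra.
    rewrite (derivable_translate (fun s => u s y) (T / 2)).
    rewrite (derive_translate (fun s => u s y) (T / 2)) subr0 -derive1E.
    have [dt _ _] := ureg rT Omy; split; first exact: dt.
    by apply: utK => //; apply/andP; split; lra.
  have fry := closure_frontier cly nOmy.
  have K0 : 0 <= K.
    by apply: le_trans (utK (T / 2) x _ Omx); [exact: normr_ge0|apply/andP; split; lra].
  by rewrite !ubd// ?subrr ?normr0 ?mulr_ge0//; apply/andP; split; lra.
have K0 : 0 <= K * h.
  by apply: le_trans (init x (subset_closure Omx)); exact: normr_ge0.
have Omx0 : Om (x + 0) by rewrite addr0.
have lateral g t0 t1 : 0 < t0 -> 0 < t0 + g -> t1 < T -> t1 + g < T ->
    forall t y, t0 <= t <= t1 -> closure Om y -> closure Om (y + 0) ->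
    ~ (Om y /\ Om (y + 0)) -> u (t + g) (y + 0) <= u t y + K * h.
  move=> t00 t0g t1T t1g t y /andP[tt0 tt1]; rewrite addr0 => cly _ nOm.
  have fry : frontier Om y by apply: (closure_frontier cly) => Omy; exact: nOm.
  by rewrite !(ubd _ fry) ?add0r//; apply/andP; split; lra.
have up : u (s + h) (x + 0) <= u s x + K * h.
  apply: (@shift_comparison h (K * h) (T / 2) s 0 _ _ _ _ _ _ s x) => //; try lra.
  - move=> y cly _; rewrite addr0 -lerBlDl.
    exact: le_trans (ler_norm _) (init y cly).
  - by apply: lateral; lra.
(* The reverse inequality is the same comparison with shift [- h], started at [T / 2 + h]. *)
have down : u (s + h + - h) (x + 0) <= u (s + h) x + K * h.
  apply: (@shift_comparison (- h) (K * h) (T / 2 + h) (s + h) 0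
    _ _ _ _ _ _ (s + h) x) => //; try lra.
  - move=> y cly _; rewrite addr0 addrK -lerBlDl.
    by apply: le_trans (ler_norm _) _; rewrite distrC; exact: init.
  - by apply: lateral; lra.
move: up down; rewrite addr0 addrK => up down.
by rewrite ler_norml; apply/andP; split; lra.
Qed.

Hypothesis hn : (0 < n)%N.
Hypothesis ugrad : forall t x i, 0 < t < T -> Om x ->
  partial i (u t) y @[y --> x] --> partial i (u t) x.

Variables (r K : R).
Hypotheses (r0 : 0 < r) (K0 : 0 <= K)
  (ext : forall x, frontier Om x -> exterior_ball Om r x)
  (utK : forall t x, T / 4 <= t <= 3 * T / 4 -> Om x ->
     `|derive1 (fun s => u s x) t| <= K).

(** For slope [a = 4 * B] with [B >= 1], the concavity demanded by [barrier_supersolution] is at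
    most this constant times the power [p] of [B]. *)
Definition barrier_const : R := 8 `^ p + 4 * n%:R / r.

(* The length of the time interval is B eta / (K + 1) with B = n M,
   A = barrier_const * B^p and eta = B / A, which scales as B^(2 - p). *)
Lemma gradient_persistence (M t0 : R) : 1 <= M -> 0 < T ->
  3 * T / 4 <= t0 -> t0 < T ->
  (forall x, Om x -> enorm (grad (u t0) x) <= M) ->
  T - t0 <= (barrier_const * (K + 1) * (n%:R * M) `^ (p - 2))^-1 ->
  exists L : R, forall t x, t0 <= t < T -> Om x -> enorm (grad (u t) x) <= L.
Proof.
move=> M1 T0 t0ge t0T gradM Tt0.
have N1 : 1 <= (n%:R : R) by rewrite ler1n.
have N0 : 0 <= (n%:R : R) by exact: ler0n.
(* [n * M] is the Lipschitz constant that [lipschitz_exit] yields from partial derivatives bounded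
   by [M]. *)
pose B := n%:R * M; pose X := B `^ (p - 2); pose C := barrier_const.
have B1 : 1 <= B by rewrite /B -[leLHS]mulr1 ler_pM.
have B0 : 0 < B by exact: lt_le_trans B1.
have X1 : 1 <= X.
  have p20 : 0 <= p - 2 by rewrite subr_ge0 ltW.
  by have := ler_powR B1 p20; rewrite powRr0.
have X0 : 0 < X by exact: lt_le_trans X1.
have BpE : B `^ p = X * B ^+ 2.
  rewrite /X -powR_mulrn ?(ltW B0)// -powRD ?subrK//.
  by apply/implyP => _; rewrite gt_eqF.
have e8 : 0 < 8 `^ p :> R by rewrite powR_gt0.
(* With [X] and [B] at least 1, this keeps the layer thinner than the ball: [eta <= r]. *)
have Cr : r^-1 <= C.
  rewrite /C /barrier_const; apply: (@le_trans _ _ (4 * n%:R / r)).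
    rewrite ler_peMl ?invr_ge0 ?(ltW r0)//; lra.
  by rewrite lerDr ltW.
have C0 : 0 < C by apply: lt_le_trans Cr; rewrite invr_gt0.
pose eta := (C * X * B)^-1; pose A := C * B `^ p.
have CXB0 : 0 < C * X * B by apply: mulr_gt0 => //; exact: mulr_gt0.
have eta0 : 0 < eta by rewrite invr_gt0.
have etar : eta <= r.
  rewrite /eta -[r]invrK lef_pV2 ?posrE ?invr_gt0//.
  apply: le_trans Cr _; rewrite -mulrA ler_peMr ?(ltW C0)//.
  by rewrite -[leLHS]mulr1; apply: ler_pM.
have Aeta : A * eta <= B.
  rewrite /A /eta BpE expr2; rewrite le_eqVlt; apply/orP; left; apply/eqP; field.
  by rewrite !gt_eqF.
have Beta : B * eta = (C * X)^-1.
  by rewrite /eta; field; rewrite !gt_eqF.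
have HA : (2 * (4 * B)) `^ p + n%:R * (4 * B / r) <= A.
  rewrite /A /C /barrier_const [leRHS]mulrDl.
  have -> : 2 * (4 * B) = 8 * B by ring.
  rewrite powRM ?(ltW B0)// lerD2l.
  have -> : n%:R * (4 * B / r) = 4 * n%:R / r * B by ring.
  apply: ler_wpM2l; first by rewrite divr_ge0 ?mulr_ge0// ltW.
  have p1 : 1 <= p by apply: ltW; apply: lt_trans p2; rewrite ltr1n.
  by have := ler_powR B1 p1; rewrite (powRr1 (ltW B0)).
have t00 : 0 < t0 by lra.
have t0T' : 0 < t0 < T by rewrite t00.
have partialM z i : Om z -> `|partial i (u t0) z| <= M.
  move=> /gradM; apply: le_trans.
  by have := coord_le_enorm (grad (u t0) z) i; rewrite mxE.
have ct0 : {within closure Om, continuous (u t0)}.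
  apply: (@continuous_within_comp _ _ _ _ _ (fun z : R * 'rV[R]_n => u z.1 z.2)
    (fun z => (t0, z)) _ _ ucont) => //; exact: continuous_slice.
have dt0 z i : Om z -> derivable (u t0) z (basis_vec i).
  by move=> Omz; have [_ d _] := ureg t0T' Omz; exact: d.
have gt0 z i : Om z -> partial i (u t0) y @[y --> z] --> partial i (u t0) z.
  exact: ugrad.
have ut0bd z : frontier Om z -> u t0 z = 0 by exact: ubd.
have M0 : 0 <= M by lra.
pose L := 4 * B * (n%:R + 1).
have L0 : 0 <= L by apply: mulr_ge0; [apply: mulr_ge0 => //; exact: ltW|exact: addr_ge0].
have BL : B <= L.
  by rewrite /L -mulrA mulrCA ler_peMr ?(ltW B0)//; lra.
(* The estimates run on [t0, t] for each [t < T], and [L] does not depend on [t]; this gives a bound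
   up to [T]. *)
exists (n%:R * L) => t x /andP[t0t tT] Omx.
apply: enorm_le_coord => // i; rewrite mxE.
have tT' : 0 < t < T by apply/andP; split; lra.
apply: (partial_le_lipschitz tT' _ i Omx) => {x Omx} x v Omx Omxv.
have tt : t0 <= t <= t by rewrite t0t lexx.
have exit y w : Om y -> ~ Om w -> `|u t0 y| <= B * enorm (w - y).
  exact: (lipschitz_exit oOm ct0 dt0 gt0 partialM M0 ut0bd).
have init y z : closure Om y -> closure Om z ->
    `|u t0 z - u t0 y| <= L * enorm (z - y).
  move=> cly clz.
  apply: le_trans (lipschitz_closure oOm ct0 dt0 gt0 partialM M0 ut0bd cly clz) _.
  by apply: ler_wpM2r => //; exact: enorm_ge0.
have tlip s y : t0 <= s <= t -> Om y -> `|u s y - u t0 y| <= B * eta.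
  move=> /andP[t0s st] Omy; rewrite Beta.
  have h0 : 0 <= s - t0 <= T / 4 by apply/andP; split; lra.
  have T2 : T / 2 <= t0 by lra.
  have sT : t0 + (s - t0) < T by lra.
  have := time_lipschitz utK h0 T2 sT Omy.
  rewrite (addrC t0) subrK => /le_trans; apply.
  have K10 : 0 < K + 1 by rewrite ltr_wpDl.
  (* The remaining time multiplied by [K + 1] is at most [(C * X)^-1], which is [B * eta]. *)
  have {}sT : s - t0 <= (C * (K + 1) * X)^-1 by apply: le_trans Tt0; lra.
  apply: (@le_trans _ _ ((K + 1) * (C * (K + 1) * X)^-1)).
    by apply: ler_pM => //; [lra|rewrite lerDl].
  by rewrite le_eqVlt; apply/orP; left; apply/eqP; field; rewrite !gt_eqF.
have bdry s y x0 : t0 <= s <= t -> closure Om y -> frontier Om x0 ->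
    `|u s y| <= L * enorm (y - x0).
  exact: (boundary_lipschitz r0 ext B0 eta0 etar
    Aeta HA t00 t0t tT exit tlip).
exact: (spatial_lipschitz t00 tT L0 bdry init tt Omx Omxv).
Qed.

End solution_estimates.

(** * Blow-up rate *)

(** Raising the assumed upper bound on [x] to the power [p - 2] and solving for [d] turns a violated
    rate into a short remaining time. *)
Lemma blowup_threshold (R : realType) (p k x d : R) : 2 < p -> 0 < k ->
  0 < x -> 0 < d ->
  x < k^-1 `^ (1 / (p - 2)) * d `^ (- (1 / (p - 2))) ->
  d <= (k * x `^ (p - 2))^-1.
Proof.
move=> p2 k0 x0 d0 xlt.
have q0 : 0 < p - 2 by rewrite subr_gt0.
have e1 : 1 / (p - 2) * (p - 2) = 1 by rewrite divfK// gt_eqF.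
have xq : x `^ (p - 2) < k^-1 * d^-1.
  have xnn : x \in Num.nneg by rewrite nnegrE ltW.
  have ynn : k^-1 `^ (1 / (p - 2)) * d `^ (- (1 / (p - 2))) \in Num.nneg.
    by rewrite nnegrE; apply: mulr_ge0; exact: powR_ge0.
  have := gt0_ltr_powR q0 xnn ynn xlt.
  rewrite powRM ?powR_ge0// -!powRrM mulNr e1 powRN.
  rewrite !powRr1 ?invr_ge0 ?(ltW k0) ?(ltW d0)//.
rewrite -[d]invrK lef_pV2 ?posrE ?invr_gt0 ?mulr_gt0 ?powR_gt0//.
by rewrite mulrC -ler_pdivlMr// mulrC ltW.
Qed.

Section classical_solution_facts.
Context {R : realType} {n : nat}.
Variables (p T : R) (Om : set 'rV[R]_n) (phi : 'rV[R]_n -> R)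
  (u : R -> 'rV[R]_n -> R).
Hypotheses (oOm : open Om) (hu : classical_solution p Om phi T%:E u).

Lemma otimeE : otime T%:E = [set t | 0 < t < T].
Proof.
apply/seteqP; split=> t /=; rewrite /otime/= lte_fin; first by case=> -> ->.
by move=> /andP[].
Qed.

Lemma solution_continuous : {within [set t | 0 < t < T] `*` closure Om,
  continuous (fun z : R * 'rV[R]_n => u z.1 z.2)}.
Proof. by rewrite -otimeE; exact: C12_continuous (cs_C12 hu). Qed.

Lemma solution_regular t x : 0 < t < T -> Om x -> regular_at u t x.
Proof.
move=> tT Omx; have ot : otime T%:E t by rewrite otimeE.
have C := cs_C12 hu; split.
- exact: (C12_derivable_t C ot Omx).
- by move=> i; exact: (C12_derivable_x C).
- by move=> i; exact: (C12_derivable_xx C).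
Qed.

Lemma solution_residual t x : 0 < t < T -> Om x ->
  heat_residual (fun v => enorm v `^ p) u t x = 0.
Proof.
move=> tT Omx; have ot : otime T%:E t by rewrite otimeE.
by rewrite /heat_residual (cs_equation hu ot Omx) subrr.
Qed.

Lemma solution_boundary t x : 0 < t < T -> frontier Om x -> u t x = 0.
Proof. by move=> tT; apply: (cs_boundary hu); rewrite otimeE. Qed.

Lemma solution_partial_continuous t x i : 0 < t < T -> Om x ->
  partial i (u t) y @[y --> x] --> partial i (u t) x.
Proof.
move=> tT Omx; have [g [cg ug]] := C12_continuous_x (cs_C12 hu).
have ot : otime T%:E t by rewrite otimeE.
have gE y : Om y -> partial i (u t) y = g (t, y) ord0 i.
  by move=> Omy; rewrite -(ug (t, y))//= mxE.
have cgt : {within Om, continuous (fun y => g (t, y))}.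
  apply: (continuous_within_comp _ _ cg); first exact: continuous_slice.
  by move=> y Omy; split=> //=; exact: subset_closure.
rewrite (continuous_open_subspace _ oOm) in cgt.
have cx : (fun y => g (t, y) ord0 i) @ x --> g (t, x) ord0 i.
  have := cgt x (mem_set Omx).
  by move=> /(@cvg_comp _ _ _ _ _ _ _ _)/(_ (@coord_continuous R 1 n ord0 i (g (t, x)))).
rewrite (gE x Omx); apply: cvg_trans cx; apply: (@near_eq_cvg _ _ (nbhs x)).
have : \forall y \near x, Om y by exact: open_nbhs_nbhs.
by apply: (@filterS _ (nbhs x)) => y /gE ->.
Qed.

(** The time derivative extends continuously to the closure for times in (0, T), so it is bounded on
    the compact set over [a, b]. *)
Lemma solution_time_derivative_bounded (a b : R) : bounded_set Om ->
  0 < a -> b < T ->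
  exists2 K : R, 0 <= K & forall t x, a <= t <= b -> Om x ->
    `|derive1 (fun s => u s x) t| <= K.
Proof.
move=> bOm a0 bT; have [g [cg ug]] := C12_continuous_t (cs_C12 hu).
pose S := `[a, b] `*` closure Om.
have cS : compact S.
  apply: compact_setX; first exact: segment_compact.
  by apply: bounded_closed_compact; [exact: bounded_closure|exact: closed_closure].
have sub : S `<=` otime T%:E `*` closure Om.
  move=> [t x] [/=]; rewrite in_itv/= => /andP[at' tb] clx; split=> //=.
  by rewrite otimeE/= (lt_le_trans a0 at') (le_lt_trans tb bT).
have /compact_bounded[M [Mr gM]] : compact (g @` S).
  exact: continuous_compact (continuous_subspaceW sub cg) cS.
exists (`|M| + 1) => [|t x tab Omx]; first exact: addr_ge0.
have St : S (t, x).
  by split=> /=; [rewrite in_itv|exact: subset_closure].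
have [ot _] := sub _ St.
have <- : g (t, x) = derive1 (fun s => u s x) t by rewrite -(ug (t, x)).
apply: gM; first by rewrite (le_lt_trans (ler_norm M))// ltrDl.
by exists (t, x).
Qed.

End classical_solution_facts.

Theorem theorem2p1 (R : realType) (n : nat) (p : R) (Omega : set 'rV[R]_n)
    (phi : 'rV[R]_n -> R) (Tstar : R) (u : R -> 'rV[R]_n -> R)
    (hn : (0 < n)%N) (hp : 2 < p)
    (hOmega : smooth_bounded_domain Omega)
    (hphi : initial_space Omega phi)
    (hu : maximal_solution p Omega phi Tstar%:E u) :
  exists C1 : R, 0 < C1 /\
    \forall t \near Tstar^'-,
      ((C1 * (Tstar - t) `^ (- (1 / (p - 2))))%:E
         <= sup_norm Omega (grad (u t)))%E.
Proof.
have oOm := sbd_open hOmega; have bOm := sbd_bounded hOmega.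
have hsol := ms_solution hu.
have T0 : 0 < Tstar by have := cs_time hsol; rewrite lte_fin.
have [r r0 ext] := uniform_exterior_ball hOmega.
have a0 : 0 < Tstar / 4 by rewrite divr_gt0.
have bT : 3 * Tstar / 4 < Tstar by lra.
have [K K0 utK] := solution_time_derivative_bounded hsol bOm a0 bT.
have N0 : 0 < (n%:R : R) by rewrite ltr0n.
pose k := @barrier_const R n p r * (K + 1).
have k0 : 0 < k.
  apply: mulr_gt0; last by rewrite ltr_wpDl.
  rewrite /barrier_const ltr_pwDl ?powR_gt0// divr_ge0 ?mulr_ge0 ?(ltW r0)//.
pose c := k^-1 `^ (1 / (p - 2)).
have c0 : 0 < c by rewrite powR_gt0// invr_gt0.
(* [c] inverts the persistence time, and [n] is the ratio of [B] to the gradient norm [M]. *)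
exists (c / n%:R); split; first exact: divr_gt0.
have blow (A : R) :
    \forall t \near Tstar^'-, (A%:E <= sup_norm Omega (grad (u t)))%E.
  exact: cvgey_ge (ms_blowup hu erefl) A.
near=> t.
have tT : t < Tstar by near: t; exact: nbhs_left_lt.
have t34 : 3 * Tstar / 4 <= t by near: t; exact: nbhs_left_ge.
(* Blow-up supplies the condition [1 <= M] of [gradient_persistence]. *)
have S1 : (1%:E <= sup_norm Omega (grad (u t)))%E by near: t; exact: blow.
rewrite leNgt; apply/negP => Slt.
have Sfin : sup_norm Omega (grad (u t)) \is a fin_num.
  by rewrite fin_numElt (lt_le_trans _ S1) ?ltNyr// (lt_trans Slt) ?ltry.
move: S1 Slt; rewrite -(fineK Sfin) lee_fin lte_fin.
set M := fine _ => M1 Mlt.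
have gradM x : Omega x -> enorm (grad (u t) x) <= M.
  move=> Omx; rewrite -lee_fin fineK//; apply: ereal_sup_ubound.
  by exists x.
have d0 : 0 < Tstar - t by rewrite subr_gt0.
have NM0 : 0 < n%:R * M by rewrite mulr_gt0// (lt_le_trans _ M1).
have short : Tstar - t <= (k * (n%:R * M) `^ (p - 2))^-1.
  apply: blowup_threshold => //.
  by move: Mlt; rewrite mulrAC ltr_pdivlMr// mulrC.
have [L Lbound] := gradient_persistence hp oOm bOm
  (solution_continuous hsol) (solution_regular hsol) (solution_residual hsol)
  (solution_boundary hsol) hn (solution_partial_continuous oOm hsol)
  r0 K0 ext utK M1 T0 t34 tT gradM short.
(* Blow-up also gives a time in [t, Tstar) with supremum at least [L + 1], against the bound [L]. *)
have [s [[ts sT] sL]] := filter_ex (filterI (filterI (nbhs_left_ge tT)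
  (nbhs_left_lt Tstar)) (blow (L + 1))).
have : (sup_norm Omega (grad (u s)) <= L%:E)%E.
  apply: ge_ereal_sup => _ [x Omx <-]; rewrite lee_fin; apply: Lbound => //.
  by rewrite ts.
by move=> /(le_trans sL); rewrite lee_fin gerDl ler10.
Unshelve. all: by end_near. Qed.
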